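(* Let $\xi\in\mathbb{C}$ with $\mathrm{Re}(\xi)>0$, and for $b\in X$ let $$C_{\xi}(b)=\sum_{a\in X}\varepsilon_0\exp\Big(-\pi\,{}^{\star}\varepsilon\,\xi\sum_{k\in L}\big(a(k)+i\tfrac{1}{\xi}b(k)\big)^2\Big).$$ If $b\in X$ is such that there exists $b_0\in{}^{*}\mathbb{R}$ with $|b(k)|\le\star(b_0)$ for all $k\in L$, then $$\mathrm{st}(C_{\xi}(b))=\Big({}^{*}\Big(\tfrac{1}{\sqrt{\xi}}\Big)\Big)^{H^2}\in{}^{*}\mathbb{C}\quad\text{and}\quad \mathbf{st}\left(\frac{C_{\xi}(b)}{\star\Big(\big({}^{*}(\tfrac{1}{\sqrt{\xi}})\big)^{H^2}\Big)}\right)=1,$$ where $\sqrt{\xi}$ is the principal square root.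
   Context: Double nonstandard framework: $F_2$ is a nonprincipal ultrafilter on an infinite set $\Lambda_2$ and ${}^{*}S=S^{\Lambda_2}/F_2$. $F_1$ is a nonprincipal ultrafilter on an infinite set $\Lambda_1$; for a ${}^*$-internal set $S$, ${}^{\star}S$ is the ${}^*$-ultrapower of $S$ with respect to ${}^*F_1$, so ${}^{\star}({}^{*}S)=S^{\Lambda_1\times\Lambda_2}/F_1^{F_2}$; ${}^{\star}x$ or $\star(x)$ denotes the image of $x$ under this embedding, and ${}^*x$ the image of a standard $x$ in ${}^*S$. ''Internal with a double meaning'' means internal for the double ultrapower. $\mathrm{st}$ denotes the standard part map from elements of ${}^{\star}({}^{*}\mathbb{C})$ bounded in absolute value by an element of ${}^*\mathbb{R}$ to ${}^{*}\mathbb{C}$ (elements of ${}^{\star}({}^{*}\mathbb{R})$ are infinitesimal if nonzero and smaller in absolute value than every positive element of ${}^*\mathbb{R}$); $\mathbf{st}$ denotes the standard part with respect to the composite embedding $\star\circ *:\mathbb{R}\to{}^{\star}({}^{*}\mathbb{R})$, i.e. $\mathbf{st}=\mathrm{st}\circ\mathrm{st}$. Let $H\in{}^{*}\mathbb{Z}$ be a positive even infinite number and $H'\in{}^{\star}({}^{*}\mathbb{Z})$ a positive even number larger than every element of ${}^{*}\mathbb{Z}$; $\varepsilon=1/H$, $\varepsilon'=1/H'$. $L=\{\varepsilon z: z\in{}^*\mathbb{Z},\,-H/2\le\varepsilon z<H/2\}$ (size $H^2$), $L'=\{\varepsilon' z': z'\in{}^{\star}({}^{*}\mathbb{Z}),\,-{}^{\star}H\frac{H'}{2}\le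 \varepsilon' z'<{}^{\star}H\frac{H'}{2}\}$. $X$ is the set of internal (double meaning) functions from ${}^{\star}L$ to $L'$, and $\varepsilon_0=({}^{\star}H)^{-({}^{\star}H)^2/2}H'^{-({}^{\star}H)^2}$. *)

(* Defs.v *)
From HB Require Import structures.
From mathcomp Require Import all_boot all_order all_algebra generic_quotient.
From mathcomp Require Import all_classical all_reals all_analysis.
From mathcomp Require Import complex.

Set Implicit Arguments.
Unset Strict Implicit.
Unset Printing Implicit Defensive.

Import Order.TTheory GRing.Theory Num.Theory.

Local Open Scope classical_set_scope.
Local Open Scope ring_scope.
Local Open Scope quotient_scope.

Record ultrafilter (I : Type) := Ultrafilter {
  uf_sets : set_system I;
  uf_ultra : UltraFilter uf_sets }.
#[global] Existing Instance uf_ultra.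

Definition nonprincipal (I : Type) (F : ultrafilter I) : Prop :=
  forall i : I, ~ uf_sets F [set i].

Section UltrafilterProduct.
Variables (I1 I2 : Type) (F1 : ultrafilter I1) (F2 : ultrafilter I2).

Definition uprod_sets : set_system (I1 * I2) :=
  [set A | uf_sets F2 [set m | uf_sets F1 [set l | A (l, m)]]].

Lemma uprod_proper : ProperFilter uprod_sets.
Proof.
split; first by rewrite /uprod_sets/= => /filter_ex[m] /filter_ex[l].
split; rewrite /uprod_sets/=.
- by apply: filterE => m; apply: filterE.
- move=> A B /= FA FB; apply: (@filterS2 _ (uf_sets F2)) FA FB => m /=.
  by move=> Am Bm; apply: (@filterS2 _ (uf_sets F1)) Am Bm => l.
- move=> A B AB /=; apply: (@filterS _ (uf_sets F2)) => m /=.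
  by apply: (@filterS _ (uf_sets F1)) => l /=; apply: AB.
Qed.

Lemma uprod_ultra : UltraFilter uprod_sets.
Proof.
have uP := uprod_proper; split=> // G GP FG.
apply/seteqP; split=> // A GA; apply: contrapT => nFA.
have FnA : uprod_sets (~` A).
  rewrite /uprod_sets/=.
  have [//|FmC] := in_ultra_setVsetC
    [set m | uf_sets F1 [set l | A (l, m)]] (uf_ultra F2).
  apply: filterS FmC => m /= nF1.
  by have [//|] := in_ultra_setVsetC [set l | A (l, m)] (uf_ultra F1).
have /filter_ex[p []//] : G (A `&` ~` A).
by apply: filterI => //; apply: FG.
Qed.

(* The ultrafilter written F_1^{F_2}: A is large iff, for F2-almost all m,
   its section over m is F1-large. *)
Definition uprod : ultrafilter (I1 * I2) := Ultrafilter uprod_ultra.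

End UltrafilterProduct.

Section Ultrapower.
Variables (I : Type) (F : ultrafilter I).

Section Carrier.
Variable T : Type.
Implicit Types f g : I -> {classic T}.

Definition ueq f g : bool := `[< uf_sets F [set i | f i = g i] >].

Lemma ueq_refl : reflexive ueq.
Proof. by move=> f; apply/asboolP; apply: filterE. Qed.

Lemma ueq_sym : symmetric ueq.
Proof. by move=> f g; apply/asboolP/asboolP; apply: filterS => i /= ->. Qed.

Lemma ueq_trans : transitive ueq.
Proof.
move=> g f h /asboolP fg /asboolP gh; apply/asboolP.
by apply: filterS2 fg gh => i /= -> ->.
Qed.

Canonical ueq_equiv := EquivRel ueq ueq_refl ueq_sym ueq_trans.

Definition ultrapower : Type := {eq_quot ueq_equiv}.
HB.instance Definition _ := Choice.on ultrapower.

Definition ucl (f : I -> T) : ultrapower := \pi_{eq_quot ueq_equiv} f.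
Definition urep (x : ultrapower) : I -> T := repr (x : {eq_quot ueq_equiv}).
Definition ucst (t : T) : ultrapower := ucl (fun=> t).

Lemma urepK (x : ultrapower) : ucl (urep x) = x.
Proof. exact: reprK. Qed.

Lemma uclP (f g : I -> T) : ucl f = ucl g <-> uf_sets F [set i | f i = g i].
Proof.
split=> [/eqP|fg]; last by apply/eqP; rewrite eqmodE; apply/asboolP.
by rewrite eqmodE => /asboolP.
Qed.

Lemma urep_ucl (f : I -> T) : uf_sets F [set i | urep (ucl f) i = f i].
Proof. by apply/uclP; rewrite urepK. Qed.

Lemma uclW (P : ultrapower -> Prop) : (forall f, P (ucl f)) -> forall x, P x.
Proof. by move=> Pucl x; rewrite -(urepK x). Qed.

End Carrier.

Section Lifting.
Variables T U V : Type.

Definition umap (f : T -> U) (x : ultrapower T) : ultrapower U :=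
  ucl (fun i => f (urep x i)).

Definition umap2 (f : T -> U -> V) (x : ultrapower T) (y : ultrapower U) :
    ultrapower V :=
  ucl (fun i => f (urep x i) (urep y i)).

Definition urel (P : T -> U -> Prop) (x : ultrapower T) (y : ultrapower U) :
    Prop :=
  uf_sets F [set i | P (urep x i) (urep y i)].

Lemma umapE f (x : I -> T) : umap f (ucl x) = ucl (fun i => f (x i)).
Proof. by apply/uclP; apply: filterS (urep_ucl x) => i /= ->. Qed.

Lemma umap2E f (x : I -> T) (y : I -> U) :
  umap2 f (ucl x) (ucl y) = ucl (fun i => f (x i) (y i)).
Proof.
by apply/uclP; apply: filterS2 (urep_ucl x) (urep_ucl y) => i /= -> ->.
Qed.

Lemma urelE P (x : I -> T) (y : I -> U) :
  urel P (ucl x) (ucl y) <-> uf_sets F [set i | P (x i) (y i)].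
Proof.
split; rewrite /urel; apply: filterS3 (urep_ucl x) (urep_ucl y) => i /=.
  by move=> -> ->.
by move=> -> ->.
Qed.

End Lifting.

Lemma uf_meet (A B : set I) : uf_sets F A -> uf_sets F B ->
  exists i, A i /\ B i.
Proof. by move=> FA FB; apply: (@filter_ex _ (uf_sets F)); apply: filterI. Qed.

Lemma uf_not (A : set I) : ~ uf_sets F A <-> uf_sets F (~` A).
Proof.
split=> [nA|FnA FA]; first by have [] := in_ultra_setVsetC A (uf_ultra F).
by have [i []] := uf_meet FA FnA.
Qed.

Lemma uf_or (A B : set I) : uf_sets F (A `|` B) -> uf_sets F A \/ uf_sets F B.
Proof.
move=> FAB; have [|/uf_not nA] := pselect (uf_sets F A); first by left.
by right; apply: filterS2 FAB nA => i [].
Qed.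

Section Zmod.
Variable T : zmodType.

Lemma uaddA : associative (umap2 (@GRing.add T)).
Proof.
elim/uclW=> x; elim/uclW=> y; elim/uclW=> z; rewrite !umap2E.
by apply/uclP; apply: filterE => i /=; rewrite addrA.
Qed.

Lemma uaddC : commutative (umap2 (@GRing.add T)).
Proof.
elim/uclW=> x; elim/uclW=> y; rewrite !umap2E.
by apply/uclP; apply: filterE => i /=; rewrite addrC.
Qed.

Lemma uadd0 : left_id (ucst 0) (umap2 (@GRing.add T)).
Proof.
elim/uclW=> x; rewrite !umap2E.
by apply/uclP; apply: filterE => i /=; rewrite add0r.
Qed.

Lemma uaddN : left_inverse (ucst 0) (umap (@GRing.opp T))
  (umap2 (@GRing.add T)).
Proof.
elim/uclW=> x; rewrite umapE umap2E.
by apply/uclP; apply: filterE => i /=; rewrite addNr.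
Qed.

HB.instance Definition _ :=
  GRing.isZmodule.Build (ultrapower T) uaddA uaddC uadd0 uaddN.

End Zmod.

Section ComRing.
Variable T : comNzRingType.

Lemma umulA : associative (umap2 (@GRing.mul T)).
Proof.
elim/uclW=> x; elim/uclW=> y; elim/uclW=> z; rewrite !umap2E.
by apply/uclP; apply: filterE => i /=; rewrite mulrA.
Qed.

Lemma umulC : commutative (umap2 (@GRing.mul T)).
Proof.
elim/uclW=> x; elim/uclW=> y; rewrite !umap2E.
by apply/uclP; apply: filterE => i /=; rewrite mulrC.
Qed.

Lemma umul1 : left_id (ucst 1) (umap2 (@GRing.mul T)).
Proof.
elim/uclW=> x; rewrite !umap2E.
by apply/uclP; apply: filterE => i /=; rewrite mul1r.
Qed.

Lemma umulDl : left_distributive (umap2 (@GRing.mul T)) (+%R).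
Proof.
elim/uclW=> x; elim/uclW=> y; elim/uclW=> z; rewrite /GRing.add/= !umap2E.
by apply/uclP; apply: filterE => i /=; rewrite mulrDl.
Qed.

Lemma uone_neq0 : ucst 1 != 0 :> ultrapower T.
Proof.
apply/eqP => /uclP/filter_ex[i /=] /eqP.
by rewrite oner_eq0.
Qed.

HB.instance Definition _ := GRing.Zmodule_isComNzRing.Build (ultrapower T)
  umulA umulC umul1 umulDl uone_neq0.

End ComRing.

Section RingE.

Lemma uadd_ucl (T : zmodType) (x y : I -> T) :
  ucl x + ucl y = ucl (fun i => x i + y i).
Proof. exact: umap2E. Qed.

Lemma uopp_ucl (T : zmodType) (x : I -> T) : - ucl x = ucl (fun i => - x i).
Proof. exact: umapE. Qed.

Lemma usub_ucl (T : zmodType) (x y : I -> T) :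
  ucl x - ucl y = ucl (fun i => x i - y i).
Proof. by rewrite uopp_ucl uadd_ucl. Qed.

Lemma umul_ucl (T : comNzRingType) (x y : I -> T) :
  ucl x * ucl y = ucl (fun i => x i * y i).
Proof. exact: umap2E. Qed.

Lemma uexp_ucl (T : comNzRingType) (x : I -> T) n :
  ucl x ^+ n = ucl (fun i => x i ^+ n).
Proof.
elim: n => [//|n IHn]; rewrite exprS IHn umul_ucl.
by apply/uclP; apply: filterE => i /=; rewrite exprS.
Qed.

End RingE.

Section ComUnitRing.
Variable T : comUnitRingType.

Definition uunit : {pred ultrapower T} :=
  fun x => `[< uf_sets F [set i | urep x i \is a GRing.unit] >].

Lemma uunitE (x : I -> T) :
  ucl x \in uunit <-> uf_sets F [set i | x i \is a GRing.unit].
Proof.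
split=> [/asboolP Fx|Fx].
  by apply: filterS2 (urep_ucl x) Fx => i /= ->.
by apply/asboolP; apply: filterS2 (urep_ucl x) Fx => i /= ->.
Qed.

Lemma umulVx : {in uunit, left_inverse 1 (umap (@GRing.inv T)) *%R}.
Proof.
elim/uclW=> x /uunitE Fx; rewrite umapE umul_ucl.
by apply/uclP; apply: filterS Fx => i /= xu; rewrite mulVr.
Qed.

Lemma uunitPl (x y : ultrapower T) : y * x = 1 -> uunit x.
Proof.
elim/uclW: x => x; elim/uclW: y => y; rewrite umul_ucl => /uclP Fxy.
apply/uunitE; apply: filterS Fxy => i /= yx1.
by apply/unitrPr; exists (y i); rewrite mulrC.
Qed.

Lemma uinv_out : {in [predC uunit], umap (@GRing.inv T) =1 id}.
Proof.
elim/uclW=> x; rewrite inE => /negP /uunitE /uf_not Fx; rewrite umapE.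
by apply/uclP; apply: filterS Fx => i /= /negP xu; rewrite invr_out.
Qed.

HB.instance Definition _ :=
  GRing.ComNzRing_hasMulInverse.Build (ultrapower T) umulVx uunitPl uinv_out.

Lemma uinv_ucl (x : I -> T) : (ucl x)^-1 = ucl (fun i => (x i)^-1).
Proof. exact: umapE. Qed.

End ComUnitRing.

Section Idomain.
Variable T : idomainType.

Lemma umul_eq0 : GRing.integral_domain_axiom (ultrapower T).
Proof.
elim/uclW=> x; elim/uclW=> y; rewrite umul_ucl => /uclP Fxy; apply/orP.
have /uf_or[Fx|Fy] :
    uf_sets F ([set i | x i = 0] `|` [set i | y i = 0]).
- apply: filterS Fxy => i /= /eqP; rewrite mulf_eq0 => /orP[] /eqP; tauto.
- by left; apply/eqP/uclP.
- by right; apply/eqP/uclP.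
Qed.

HB.instance Definition _ :=
  GRing.ComUnitRing_isIntegral.Build (ultrapower T) umul_eq0.

End Idomain.

Section Field.
Variable T : fieldType.

Lemma ufieldP : GRing.field_axiom (ultrapower T).
Proof.
elim/uclW=> x /eqP x0; apply/uunitE.
have /uf_not : ~ uf_sets F [set i | x i = 0] by move=> /uclP.
by apply: filterS => i /= nx0; rewrite unitfE; apply/eqP.
Qed.

HB.instance Definition _ :=
  GRing.UnitRing_isField.Build (ultrapower T) ufieldP.

End Field.

Section NumDomain.
Variable T : numDomainType.

Definition ule : rel (ultrapower T) :=
  fun x y => `[< urel (fun s t => s <= t) x y >].
Definition ult : rel (ultrapower T) :=
  fun x y => `[< urel (fun s t => s < t) x y >].

Lemma uleP (x y : I -> T) :
  ule (ucl x) (ucl y) <-> uf_sets F [set i | x i <= y i].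
Proof. by split=> [/asboolP/urelE|Fxy] //; apply/asboolP/urelE. Qed.

Lemma ultP (x y : I -> T) :
  ult (ucl x) (ucl y) <-> uf_sets F [set i | x i < y i].
Proof. by split=> [/asboolP/urelE|Fxy] //; apply/asboolP/urelE. Qed.

Let unorm (x : ultrapower T) := umap (fun t : T => `|t|) x.

Lemma unormD (x y : ultrapower T) : ule (unorm (x + y)) (unorm x + unorm y).
Proof.
elim/uclW: x => x; elim/uclW: y => y; rewrite /unorm uadd_ucl !umapE uadd_ucl.
by apply/uleP; apply: filterE => i /=; apply: ler_normD.
Qed.

Lemma uadd_gt0 (x y : ultrapower T) : ult 0 x -> ult 0 y -> ult 0 (x + y).
Proof.
elim/uclW: x => x; elim/uclW: y => y /ultP x0 /ultP y0.
rewrite uadd_ucl; apply/ultP; apply: filterS2 x0 y0 => i /=.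
exact: addr_gt0.
Qed.

Lemma unorm_eq0 (x : ultrapower T) : unorm x = 0 -> x = 0.
Proof.
elim/uclW: x => x; rewrite /unorm umapE => /uclP Fx; apply/uclP.
by apply: filterS Fx => i /= /normr0P/eqP.
Qed.

Lemma uge_total (x y : ultrapower T) :
  ule 0 x -> ule 0 y -> ule x y || ule y x.
Proof.
elim/uclW: x => x; elim/uclW: y => y /uleP x0 /uleP y0; apply/orP.
have /uf_or[|] : uf_sets F
    ([set i | x i <= y i] `|` [set i | y i <= x i]).
- apply: filterS2 x0 y0 => i /= xi yi; apply/orP.
  exact: ger_leVge.
- by move=> /uleP; left.
- by move=> /uleP; right.
Qed.

Lemma unormM : {morph unorm : x y / x * y}.
Proof.
elim/uclW=> x; elim/uclW=> y; rewrite /unorm umul_ucl !umapE umul_ucl.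
by apply/uclP; apply: filterE => i /=; rewrite normrM.
Qed.

Lemma ule_def (x y : ultrapower T) : ule x y = (unorm (y - x) == y - x).
Proof.
elim/uclW: x => x; elim/uclW: y => y; rewrite /unorm usub_ucl umapE.
apply/idP/eqP => [/uleP Fxy|/uclP Fxy].
  by apply/uclP; apply: filterS Fxy => i /= xy; rewrite ger0_norm// subr_ge0.
apply/uleP; apply: filterS Fxy => i /= xy.
by rewrite -subr_ge0 -xy.
Qed.

Lemma ult_def (x y : ultrapower T) : ult x y = (y != x) && ule x y.
Proof.
elim/uclW: x => x; elim/uclW: y => y; apply/idP/andP => [/ultP xy|[/eqP]].
  split; last by apply/uleP; apply: filterS xy => i /= /ltW.
  apply/eqP => /uclP yx; have [i /= []] := uf_meet xy yx.
  by move=> /[swap] ->; rewrite ltxx.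
move=> nyx /uleP xy; apply/ultP.
have /uf_not nyx' : ~ uf_sets F [set i | y i = x i] by move=> /uclP.
apply: filterS2 xy nyx' => i /= xyi yxi.
by rewrite lt_neqAle xyi andbT; apply/eqP => /esym.
Qed.

HB.instance Definition _ := Num.IntegralDomain_isNumRing.Build (ultrapower T)
  unormD uadd_gt0 unorm_eq0 uge_total unormM ule_def ult_def.

Lemma ule_ucl (x y : I -> T) :
  ucl x <= ucl y <-> uf_sets F [set i | x i <= y i].
Proof. exact: uleP. Qed.

Lemma ult_ucl (x y : I -> T) :
  ucl x < ucl y <-> uf_sets F [set i | x i < y i].
Proof. exact: ultP. Qed.

Lemma unorm_ucl (x : I -> T) : `|ucl x| = ucl (fun i => `|x i|).
Proof. exact: umapE. Qed.

End NumDomain.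

Section RealDomain.
Variable T : realDomainType.

Lemma ureal : Num.real_axiom (ultrapower T).
Proof.
elim/uclW=> x; apply/orP.
have /uf_or[|] : uf_sets F ([set i | 0 <= x i] `|` [set i | x i <= 0]).
- by apply: filterE => i /=; apply/orP; apply: le_total.
- by move=> /ule_ucl; left.
- by move=> /ule_ucl; right.
Qed.

HB.instance Definition _ := Num.NumDomain_isReal.Build (ultrapower T) ureal.

End RealDomain.

(* An internal function is an element of the ultrapower of a function space,
   an internal set one of the ultrapower of a powerset. *)
Definition uapp (T U : Type) (a : ultrapower (T -> U)) (x : ultrapower T) :
    ultrapower U :=
  umap2 (fun f t => f t) a x.

Definition uext (T : Type) (A : ultrapower (set T)) : set (ultrapower T) :=
  [set x | urel (fun t S => S t) x A].

Lemma uapp_ucl (T U : Type) (f : I -> T -> U) (x : I -> T) :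
  uapp (ucl f) (ucl x) = ucl (fun i => f i (x i)).
Proof. exact: umap2E. Qed.

Lemma uext_ucl (T : Type) (S : I -> set T) (x : I -> T) :
  uext (ucl S) (ucl x) <-> uf_sets F [set i | S i (x i)].
Proof. exact: urelE. Qed.

Lemma uext_sub (T : Type) (P Q : I -> set T) :
  uext (ucl P) `<=` uext (ucl Q) <-> uf_sets F [set i | P i `<=` Q i].
Proof.
split=> [|FPQ]; last first.
  elim/uclW=> x /uext_ucl Px; apply/uext_ucl.
  by apply: filterS2 FPQ Px => i /=; apply.
move=> PQ; apply: contrapT => /uf_not nsub.
have /choice[t tP] : forall i, exists t : option T,
    ~ (P i `<=` Q i) -> exists u, t = Some u /\ P i u /\ ~ Q i u.
  move=> i; have [|nPQ] := pselect (P i `<=` Q i); first by exists None.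
  have [u [Pu nQu]] : exists u, P i u /\ ~ Q i u.
    apply: contrapT => nex; apply: nPQ => u Pu; apply: contrapT => nQu.
    by apply: nex; exists u.
  by exists (Some u) => _; exists u.
have [i0 /= /tP[u0 _]] := filter_ex nsub.
pose x i := odflt u0 (t i).
have /PQ/uext_ucl Qx : uext (ucl P) (ucl x).
  apply/uext_ucl; apply: filterS nsub => i /= /tP[u [tu [Pu _]]].
  by rewrite /x tu.
have [i /= [/tP[u [tu [_ nQu]]]]] := uf_meet nsub Qx.
by rewrite /x tu.
Qed.

Section HyperfiniteSum.
Variables (T : choiceType) (V : zmodType).

(* s is the internal sum of g over the hyperfinite internal set A, on which g
   is internal. *)
Definition is_hsum (A : set (ultrapower T)) (g : ultrapower T -> ultrapower V)
    (s : ultrapower V) : Prop :=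
  exists (S : I -> set T) (f : I -> T -> V),
    [/\ forall i, finite_set (S i),
        A = uext (ucl S),
        forall x, A x -> g x = uapp (ucl f) x
      & s = ucl (fun i => \sum_(t \in S i) f i t)].

Definition hsum (A : set (ultrapower T)) (g : ultrapower T -> ultrapower V) :
    ultrapower V :=
  xget 0 [set s | is_hsum A g s].

Lemma is_hsum_uniq A g s s' : is_hsum A g s -> is_hsum A g s' -> s = s'.
Proof.
move=> [S [f [finS AS gf ->]]] [S' [f' [finS' AS' gf' ->]]]; apply/uclP.
have SS' : uf_sets F [set i | S i = S' i].
  have s1 : uf_sets F [set i | S i `<=` S' i] by apply/uext_sub; rewrite -AS AS'.
  have s2 : uf_sets F [set i | S' i `<=` S i] by apply/uext_sub; rewrite -AS' AS.
  by apply: filterS2 s1 s2 => i /= ? ?; apply/seteqP.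
have ff' : uf_sets F [set i | forall t, S i t -> f i t = f' i t].
  have : uext (ucl S) `<=` uext (ucl (fun i => [set t | f i t = f' i t])).
    elim/uclW => x; rewrite -AS => Ax; apply/uext_ucl.
    by move: (gf _ Ax); rewrite (gf' _ Ax) !uapp_ucl => /uclP; apply: filterS.
  by move=> /uext_sub.
apply: filterS2 SS' ff' => i /= <- ff'; apply: eq_fsbigr => t.
by rewrite inE => /ff'.
Qed.

Lemma hsumE A g s : is_hsum A g s -> hsum A g = s.
Proof.
move=> gs; apply: is_hsum_uniq (gs).
by apply: (@xgetPex _ 0 [set s | is_hsum A g s]); exists s.
Qed.

End HyperfiniteSum.

End Ultrapower.

Section DoubleNonstandard.
Variables (I1 I2 : Type) (F1 : ultrafilter I1) (F2 : ultrafilter I2).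

Definition ustar (T : Type) (x : ultrapower F2 T) :
    ultrapower (uprod F1 F2) T :=
  ucl (uprod F1 F2) (fun p => urep x p.2).

Lemma ustar_ucl (T : Type) (x : I2 -> T) :
  ustar (ucl F2 x) = ucl (uprod F1 F2) (fun p => x p.2).
Proof.
apply/uclP; apply: filterS (urep_ucl F2 x) => m /= xm.
exact: filterE.
Qed.

Definition dstd (T : Type) (t : T) : ultrapower (uprod F1 F2) T :=
  ustar (ucst F2 t).

(* The *-ultrapower of A with respect to *F1: the classes of the internal
   functions from *I1 to A. The class of f : I1 * I2 -> T corresponds to the
   internal function sending the class of l : I2 -> I1 to the class of
   m |-> f (l m, m). *)
Definition ustar_set (T : Type) (A : set (ultrapower F2 T)) :
    set (ultrapower (uprod F1 F2) T) :=
  [set x | exists f : I1 * I2 -> T,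
     x = ucl (uprod F1 F2) f /\
     forall l : I2 -> I1, A (ucl F2 (fun m => f (l m, m)))].

End DoubleNonstandard.
Arguments ustar {I1 I2} F1 {F2 T} x.
Arguments dstd {I1 I2} F1 F2 {T} t.
Arguments ustar_set {I1 I2} F1 {F2 T} A.

Definition hR (R : realType) (I : Type) (F : ultrafilter I) :
  ultrapower F int -> ultrapower F R := umap (fun z : int => z%:~R).
Definition hC (R : realType) (I : Type) (F : ultrafilter I) :
  ultrapower F R -> ultrapower F R[i] := umap (fun x : R => x%:C%C).
Definition hnormc (R : realType) (I : Type) (F : ultrafilter I) :
  ultrapower F R[i] -> ultrapower F R := umap (@ComplexField.Normc.normc R).

Definition cexp (R : realType) (z : R[i]) : R[i] :=
  ((expR (complex.Re z))%:C * (cos (complex.Im z) +i* sin (complex.Im z)))%C.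
Definition hcexp (R : realType) (I : Type) (F : ultrafilter I) :
  ultrapower F R[i] -> ultrapower F R[i] := umap (@cexp R).

Definition hpowR (R : realType) (I : Type) (F : ultrafilter I) :
  ultrapower F R -> ultrapower F R -> ultrapower F R := umap2 (@powR R).
Definition hexprz (T : unitRingType) (I : Type) (F : ultrafilter I) :
  ultrapower F T -> ultrapower F int -> ultrapower F T := umap2 (@exprz T).

Section StandardPart.
Variables (R : realType) (I1 I2 : Type).
Variables (F1 : ultrafilter I1) (F2 : ultrafilter I2).
Implicit Types x : ultrapower (uprod F1 F2) R[i].

Definition star_bounded x : Prop :=
  exists r : ultrapower F2 R, hnormc x <= ustar F1 r.

(* st and bst take the junk value 0 outside their domains, which are
   star_bounded and std_bounded. *)
Definition st x : ultrapower F2 R[i] :=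
  xget 0 [set y | forall d : ultrapower F2 R, 0 < d ->
                    hnormc (x - ustar F1 y) < ustar F1 d].

Definition std_bounded x : Prop := exists r : R, hnormc x <= dstd F1 F2 r.

Definition bst x : R[i] :=
  xget 0 [set y | forall d : R, 0 < d ->
                    hnormc (x - dstd F1 F2 y) < dstd F1 F2 d].

End StandardPart.

Section Lattices.
Variables (R : realType) (I1 I2 : Type).
Variables (F1 : ultrafilter I1) (F2 : ultrafilter I2).
Variables (H : ultrapower F2 int) (H' : ultrapower (uprod F1 F2) int).

Local Notation RR := (ultrapower (uprod F1 F2) R).
Local Notation CC := (ultrapower (uprod F1 F2) R[i]).

Definition eps : ultrapower F2 R := (hR R H)^-1.
Definition eps' : RR := (hR R H')^-1.
Definition sH : RR := hR R (ustar F1 H).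

Definition latL : set (ultrapower F2 R) :=
  [set x | exists z : ultrapower F2 int,
     x = eps * hR R z /\ - (hR R H / 2) <= x < hR R H / 2].

Definition latL' : set RR :=
  [set x | exists z : ultrapower (uprod F1 F2) int,
     x = eps' * hR R z /\
     - (sH * (hR R H' / 2)) <= x < sH * (hR R H' / 2)].

Definition starL : set RR := ustar_set F1 latL.

(* An internal function from starL to L' is represented by its extension by 0
   to an internal function on the double ultrapower of R. *)
Definition Xset : set (ultrapower (uprod F1 F2) (R -> R)) :=
  [set a | (forall k, starL k -> latL' (uapp a k)) /\
           (forall k, ~ starL k -> uapp a k = 0)].

Definition eps0 : RR :=
  hpowR sH (- (sH ^+ 2) / 2) * hpowR (hR R H') (- sH ^+ 2).

Definition Cxi (xi : R[i]) (b : ultrapower (uprod F1 F2) (R -> R)) : CC :=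
  hsum Xset (fun a =>
    hC eps0 *
    hcexp (- (hC (dstd F1 F2 (pi : R)) * hC (ustar F1 eps) * dstd F1 F2 xi *
      hsum starL (fun k =>
        (hC (uapp a k) + dstd F1 F2 ('i%C * xi^-1) * hC (uapp b k)) ^+ 2)))).

End Lattices.

(* Main.v *)
From HB Require Import structures.
Require Import Defs.
From mathcomp Require Import all_boot all_order all_algebra.
From mathcomp Require Import all_classical all_reals all_analysis complex.
From mathcomp Require Import ring lra.

(* Over a fixed index m of F2 the set L is a fixed finite grid, and C factors
   as a product, over the points k of that grid, of one-dimensional Riemann sums
   of a complex Gaussian whose mesh 1/H' tends to 0 and whose range tends to
   the whole line along F1. Each factor therefore tends to 1/sqrt(xi), whatever
   the bounded shift b(k), and the finite product to its power; a choice of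
   representatives turns this fibrewise convergence into the two statements on
   standard parts.

   The limit of the Riemann sums is obtained without complex integration. The
   line x |-> w x + g (w proportional to sqrt(xi)) is joined to the real line by
   x |-> W x + G with (W, G) linear in a parameter s, and
     d/ds (W e^{-(W x + G)^2}) = d/dx ((W' x + G') e^{-(W x + G)^2}).
   The sum over the grid of the right-hand side telescopes up to O(mesh), hence
   the Riemann sum is almost independent of s, and at the real line it is
   compared with the Gaussian integral. *)

Set Implicit Arguments.
Unset Strict Implicit.
Unset Printing Implicit Defensive.

Import Order.TTheory GRing.Theory Num.Theory.
Import numFieldNormedType.Exports ComplexField.Normc.
Local Open Scope classical_set_scope.
Local Open Scope ring_scope.

(** * Complex numbers *)

(* The libraries put the topology of the norm of [R[i]] on the alias [R[i]^o]
   only. *)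
HB.instance Definition _ (R : rcfType) := NormedModule.copy R[i] R[i]^o.

Section ComplexModulus.
Variable R : rcfType.
Implicit Types (x a b : R) (z w : R[i]).

Lemma normc_ge0 z : 0 <= normc z.
Proof. by case: z => a b; apply: sqrtr_ge0. Qed.

Lemma ler_normcD z w : normc (z + w) <= normc z + normc w.
Proof. exact: (@le_normcD R z w). Qed.

Lemma ler_normcB z w : normc (z - w) <= normc z + normc w.
Proof. by rewrite -(@normcN R w); apply: ler_normcD. Qed.

Lemma ler_normc_sum (I : Type) (r : seq I) (P : pred I) (F : I -> R[i]) :
  normc (\sum_(i <- r | P i) F i) <= \sum_(i <- r | P i) normc (F i).
Proof.
elim/big_ind2: _ => // [|z a w b za wb]; first by rewrite normc0.
exact: le_trans (ler_normcD _ _) (lerD za wb).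
Qed.

Lemma normc_real x : normc x%:C%C = `|x|.
Proof. by rewrite /normc /= expr0n /= addr0 sqrtr_sqr. Qed.

Lemma normc_nat n : normc (n%:R : R[i]) = n%:R.
Proof. by rewrite -(rmorph_nat (real_complex R)) normc_real ger0_norm. Qed.

Lemma normcX z n : normc (z ^+ n) = normc z ^+ n.
Proof. by elim: n => [|n IHn]; rewrite ?expr0 ?normc1// !exprS normcM IHn. Qed.

Lemma ler_normcX z x n : normc z <= x -> normc z ^+ n <= x ^+ n.
Proof.
by move=> zx; rewrite lerXn2r ?nnegrE ?(le_trans _ zx) ?normc_ge0.
Qed.

Lemma normc_realM_le x z : 0 <= x <= 1 -> normc (x%:C%C * z) <= normc z.
Proof.
move=> /andP[x0 x1].
by rewrite normcM normc_real ger0_norm// ler_piMl ?normc_ge0.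
Qed.

Lemma normc_sqr_shift_le x a b z w : 0 <= x <= 1 ->
  normc z <= a -> normc w <= b ->
  normc (2 * z * w + x%:C%C * w ^+ 2) <= 2 * (a * b) + b ^+ 2.
Proof.
move=> x01 za wb; apply: le_trans (ler_normcD _ _) (lerD _ _).
  by rewrite -mulrA 2!normcM normc_nat ler_wpM2l// ler_pM ?normc_ge0.
by apply: le_trans (normc_realM_le _ x01) _; rewrite normcX ler_normcX.
Qed.

Lemma ReB z w : complex.Re (z - w) = complex.Re z - complex.Re w.
Proof. by case: z w => [a b] [c d]. Qed.

Lemma ImB z w : complex.Im (z - w) = complex.Im z - complex.Im w.
Proof. by case: z w => [a b] [c d]. Qed.

Lemma Re_realM x z : complex.Re (x%:C%C * z) = x * complex.Re z.
Proof. by case: z => a b /=; rewrite mul0r subr0. Qed.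

Lemma Im_realM x z : complex.Im (x%:C%C * z) = x * complex.Im z.
Proof. by case: z => a b /=; rewrite mul0r addr0. Qed.

Lemma ler_Re_normc z : `|complex.Re z| <= normc z.
Proof. by rewrite -lecR; apply: normc_ge_Re. Qed.

Lemma Re_mul_conjc_le z w : complex.Re (z * w^*%C) <= normc z * normc w.
Proof.
apply: le_trans (ler_norm _) (le_trans (ler_Re_normc _) _).
by rewrite normcM; case: w => c d /=; rewrite sqrrN.
Qed.

End ComplexModulus.

Section ComplexLimits.
Context {R : realType} {T : Type} {F : set_system T} {FF : Filter F}.
Implicit Types (f g : T -> R[i]) (u : T -> R).

Lemma cvgc_distP f (l : R[i]) : f @ F --> l <->
  forall e : R, 0 < e -> \forall t \near F, normc (f t - l) < e.
Proof.
split=> [/cvgrPdist_lt fl e e0|fl].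
  have /fl : 0 < e%:C%C :> R[i] by rewrite ltcR.
  by apply: filterS => t; rewrite distrC -ltcR.
apply/cvgrPdist_lt => -[e e'] /=; rewrite ltcE /= => /andP[/eqP -> /fl].
by apply: filterS => t; rewrite -ltcR distrC.
Qed.

Lemma cvgc_normB0 f g (l : R[i]) :
  normc (f t - g t) @[t --> F] --> (0 : R) -> g @ F --> l -> f @ F --> l.
Proof.
move=> /cvgr0Pnorm_lt fg0 /cvgc_distP gl; apply/cvgc_distP => e e0.
have e2 : 0 < e / 2 by rewrite divr_gt0.
apply: filterS2 (fg0 _ e2) (gl _ e2) => t; rewrite ger0_norm ?normc_ge0//.
move=> fg_lt g_lt; rewrite -(subrKA (g t)) (splitr e).
exact: le_lt_trans (ler_normcD _ _) (ltrD fg_lt g_lt).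
Qed.

Lemma cvg_real_complex u (l : R) : u @ F --> l ->
  (u t)%:C%C @[t --> F] --> (l%:C%C : R[i]).
Proof.
move=> /cvgrPdist_lt ul; apply/cvgc_distP => e /ul.
by apply: filterS => t; rewrite -rmorphB normc_real distrC.
Qed.

Lemma cvgc_near_le f (l : R[i]) : f @ F --> l ->
  \forall t \near F, normc (f t) <= normc l + 1.
Proof.
move=> /cvgc_distP/(_ 1 ltr01); apply: filterS => t ft.
by rewrite -{1}(subrKC l (f t)) (le_trans (ler_normcD _ _))// lerD2l ltW.
Qed.

End ComplexLimits.

Section IncrementBounds.
Variable R : realType.
Implicit Types a b s t : R.

(* Apply the mean value theorem to [Re (F * (F b - F a)^* )]. *)
Lemma normc_mean_value (F dF : R -> R[i]) a b (K : R) : a <= b ->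
  (forall t, is_derive t 1 (fun t => complex.Re (F t)) (complex.Re (dF t))) ->
  (forall t, is_derive t 1 (fun t => complex.Im (F t)) (complex.Im (dF t))) ->
  (forall t, a <= t <= b -> normc (dF t) <= K) ->
  normc (F b - F a) <= K * (b - a).
Proof.
move=> ab dRe dIm dFK; set D := F b - F a.
have K_ge0 : 0 <= K by rewrite (le_trans (normc_ge0 (dF a)))// dFK// lexx.
have [|D_gt0] := leP (normc D) 0.
  by move=> /le_trans; apply; rewrite mulr_ge0// subr_ge0.
pose f t := complex.Re D * complex.Re (F t) + complex.Im D * complex.Im (F t).
have df t : is_derive t 1 f (complex.Re (dF t * D^*%C)).
  have -> : complex.Re (dF t * D^*%C) =
      complex.Re D *: complex.Re (dF t) + complex.Im D *: complex.Im (dF t).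
    by case: (dF t) D {D_gt0 f} => p q [u v] /=; rewrite /GRing.scale /=; ring.
  exact: is_deriveD.
have cf : {within `[a, b], continuous f}.
  apply: continuous_subspaceT => t; apply: differentiable_continuous.
  exact/derivable1_diffP.
have [t t_in fE] := MVT_segment ab (fun t _ => df t) cf.
have dFt : normc (dF t) <= K by apply: dFK; move: t_in; rewrite in_itv.
have normD2 : normc D * normc D = f b - f a.
  transitivity (complex.Re D ^+ 2 + complex.Im D ^+ 2).
    case: (D) => p q /=.
    by rewrite -expr2 sqr_sqrtr// addr_ge0// sqr_ge0.
  by rewrite /f /D; case: (F b) (F a) => [p q] [u v] /=; ring.
rewrite -(ler_pM2r D_gt0) normD2 fE mulrAC ler_wpM2r ?subr_ge0//.
by rewrite (le_trans (Re_mul_conjc_le _ _))// ler_wpM2r ?normc_ge0.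
Qed.

(* Cut [[a, b]] into steps so small that the quadratic terms are negligible. *)
Lemma normc_increment_le (Phi : R -> R[i]) a b (e K : R) : a <= b ->
  (forall s t, a <= s -> 0 <= t -> s + t <= b ->
     normc (Phi (s + t) - Phi s) <= t * e + t ^+ 2 * K) ->
  normc (Phi b - Phi a) <= (b - a) * e.
Proof.
move=> ab step; apply/ler_addgt0Pr => d d_gt0.
pose n := Num.truncn ((b - a) ^+ 2 * `|K| / d); pose N : R := n.+1%:R.
pose tau := (b - a) / N; pose node i := a + i%:R * tau.
have N_gt0 : 0 < N by rewrite ltr0n.
have tau_ge0 : 0 <= tau by rewrite divr_ge0 ?subr_ge0// ltW.
have NtauE : N * tau = b - a by rewrite mulrC divfK ?gt_eqF.
have tauK : (b - a) * (tau * K) <= d.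
  have -> : (b - a) * (tau * K) = (b - a) ^+ 2 * K / N.
    by rewrite /tau; field; rewrite gt_eqF.
  rewrite ler_pdivrMr// (le_trans (ler_wpM2l (sqr_ge0 _) (ler_norm K)))//.
  by rewrite [leRHS]mulrC -ler_pdivrMr// ltW// truncnS_gt.
have -> : Phi b - Phi a = \sum_(0 <= i < n.+1) (Phi (node i.+1) - Phi (node i)).
  by rewrite (telescope_sumr (Phi \o node))//= /node NtauE mul0r addr0 subrKC.
apply: le_trans (ler_normc_sum _ _ _) _.
apply: (@le_trans _ _ (\sum_(0 <= i < n.+1) tau * (e + tau * K))).
  apply: ler_sum_nat => i /andP[_ iN].
  have nodeS : node i.+1 = node i + tau by rewrite /node -natr1; ring.
  rewrite nodeS mulrDr mulrA -expr2; apply: step => //.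
    by rewrite lerDl mulr_ge0.
  by rewrite -nodeS -(subrKC a b) lerD2l -NtauE ler_wpM2r// ler_nat.
by rewrite sumr_const_nat subn0 -mulr_natl mulrA NtauE mulrDr lerD2l.
Qed.

End IncrementBounds.

Section ComplexExponential.
Variable R : realType.
Implicit Types z w v : R[i].

Lemma cexpD z w : cexp (z + w) = cexp z * cexp w.
Proof.
case: z w => [a b] [c d]; rewrite /cexp /= expRD sinD cosD.
by apply/eqP; rewrite eq_complex /=; apply/andP; split; apply/eqP; ring.
Qed.

Lemma cexp0 : cexp (0 : R[i]) = 1.
Proof. by rewrite /cexp /= expR0 cos0 sin0 mul1r. Qed.

Lemma cexp_sum (I : Type) (r : seq I) (P : pred I) (F : I -> R[i]) :
  cexp (\sum_(i <- r | P i) F i) = \prod_(i <- r | P i) cexp (F i).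
Proof. exact: (big_morph (@cexp R) cexpD cexp0). Qed.

Lemma cexp_real (x : R) : cexp x%:C%C = (expR x)%:C%C.
Proof. by rewrite /cexp /= cos0 sin0 -[(1 +i* 0)%C]/(1 : R[i]) mulr1. Qed.

Lemma normc_cexp z : normc (cexp z) = expR (complex.Re z).
Proof.
rewrite /cexp normcM normc_real ger0_norm ?expR_ge0//= cos2Dsin2 sqrtr1.
by rewrite mulr1.
Qed.

Lemma normc_cexp_le z : normc (cexp z) <= expR (normc z).
Proof.
by rewrite normc_cexp ler_expR (le_trans (ler_norm _)) ?ler_Re_normc.
Qed.

Lemma is_derive_Re_cexp v (t : R) :
  is_derive t 1 (fun t => complex.Re (cexp (t%:C%C * v)))
    (complex.Re (v * cexp (t%:C%C * v))).
Proof.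
rewrite /cexp; under eq_fun do rewrite Re_realM Re_realM Im_realM /=.
apply: is_derive_eq; rewrite Re_realM Im_realM; case: v => a b /=.
by rewrite /GRing.scale /= !mul0r subr0 !addr0; ring.
Qed.

Lemma is_derive_Im_cexp v (t : R) :
  is_derive t 1 (fun t => complex.Im (cexp (t%:C%C * v)))
    (complex.Im (v * cexp (t%:C%C * v))).
Proof.
rewrite /cexp; under eq_fun do rewrite Im_realM Re_realM Im_realM /=.
apply: is_derive_eq; rewrite Re_realM Im_realM; case: v => a b /=.
by rewrite /GRing.scale /= !mul0r subr0 !addr0; ring.
Qed.

Lemma normc_cexp_sub1_le v : normc (cexp v - 1) <= normc v * expR (normc v).
Proof.
have := normc_mean_value (K := normc v * expR (normc v)) ler01
  (is_derive_Re_cexp v) (is_derive_Im_cexp v).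
rewrite mul1r mul0r cexp0 subr0 mulr1; apply => t t01.
rewrite normcM ler_wpM2l ?normc_ge0// (le_trans (normc_cexp_le _))// ler_expR.
exact: normc_realM_le.
Qed.

Lemma normc_cexp_taylor1_le v :
  normc (cexp v - 1 - v) <= normc v ^+ 2 * expR (normc v).
Proof.
have := @normc_mean_value R (fun t => cexp (t%:C%C * v) - t%:C%C * v)
  (fun t => v * cexp (t%:C%C * v) - v) 0 1 (normc v ^+ 2 * expR (normc v)).
rewrite mul1r mul0r cexp0 !subr0 mulr1 addrAC; apply => // [t|t|t t01].
- under eq_fun do rewrite ReB (Re_realM _ v).
  have dcexp := is_derive_Re_cexp v t.
  by apply: is_derive_eq; rewrite ReB /GRing.scale /= mulr0 add0r mulr1.
- under eq_fun do rewrite ImB (Im_realM _ v).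
  have dcexp := is_derive_Im_cexp v t.
  by apply: is_derive_eq; rewrite ImB /GRing.scale /= mulr0 add0r mulr1.
- rewrite -[X in _ - X]mulr1 -mulrBr normcM expr2 -mulrA.
  rewrite ler_wpM2l ?normc_ge0// (le_trans (normc_cexp_sub1_le _))//.
  by rewrite ler_pM ?normc_ge0 ?expR_ge0 ?ler_expR ?normc_realM_le.
Qed.

End ComplexExponential.

(** * Sums over a grid *)

Section Grid.
Variable R : realType.
Implicit Types (x dl : R) (M : nat).

Definition grid dl M : seq R :=
  [seq dl * (j%:R - M%:R) | j <- index_iota 0 (M + M)].

Lemma gridP dl M x : 0 < dl -> x \in grid dl M <->
  exists z : int, x = dl * z%:~R /\ - (dl * M%:R) <= x < dl * M%:R.
Proof.
move=> dl0; split=> [/mapP[j]|[z [-> /andP[]]]].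
  rewrite mem_index_iota /= => jM ->; exists (j%:Z - M%:Z).
  rewrite intrD mulrNz; split=> //.
  rewrite -mulrN ler_pM2l// ltr_pM2l// lerBrDr addNr ler0n ltrBlDr.
  by rewrite -natrD ltr_nat.
rewrite -mulrN ler_pM2l// ltr_pM2l// -[M%:R]/(M%:Z%:~R) -mulrNz.
rewrite ler_int ltr_int => Mz zM.
have zM0 : 0 <= z + M%:Z by rewrite -lerBlDr sub0r.
have [n nE] : exists n : nat, z + M%:Z = n.
  by exists (absz (z + M%:Z)); rewrite gez0_abs.
apply/mapP; exists n.
  by rewrite mem_index_iota /= -ltz_nat -nE PoszD ltrD2r.
by congr (_ * _); rewrite -[n%:R]/(n%:Z%:~R) -nE intrD addrK.
Qed.

Lemma uniq_grid dl M : dl != 0 -> uniq (grid dl M).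
Proof.
move=> dl0; rewrite map_inj_uniq ?iota_uniq// => i j /(mulfI dl0)/addIr/eqP.
by rewrite eqr_nat => /eqP.
Qed.

Lemma size_grid dl M : size (grid dl M) = (M + M)%N.
Proof. by rewrite size_map size_iota subn0. Qed.

Lemma telescope_grid (V : zmodType) (f : R -> V) dl M :
  \sum_(x <- grid dl M) (f (x + dl) - f x) = f (dl * M%:R) - f (- (dl * M%:R)).
Proof.
rewrite big_map (telescope_sumr_eq (fun j => f (dl * (j%:R - M%:R))))//.
  by rewrite natrD addrK sub0r mulrN.
by move=> j _; congr (f _ - _); rewrite -natr1; ring.
Qed.

Lemma sum_grid_split (V : nmodType) (f : R -> V) dl M :
  \sum_(x <- grid dl M) f x =
  \sum_(0 <= j < M) (f (- (dl * j.+1%:R)) + f (dl * j%:R)).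
Proof.
rewrite big_map (@big_cat_nat _ _ _ M) ?leq_addr//= big_split/=; congr (_ + _).
  rewrite big_nat_rev /= [LHS]big_nat [RHS]big_nat; apply: eq_bigr => j.
  by rewrite add0n => /= jM; congr f; rewrite natrB//; ring.
rewrite -{1}[M]add0n big_addn addnK; apply: eq_bigr => j _; congr f.
by rewrite natrD addrK.
Qed.

Lemma sum_expRN_le1 dl n : 0 < dl ->
  \sum_(0 <= j < n) dl * expR (- (dl * j.+1%:R)) <= 1.
Proof.
move=> dl0.
have : \sum_(0 <= j < n) dl * expR (- (dl * j.+1%:R)) <=
    \sum_(0 <= j < n) (- expR (- (dl * j.+1%:R)) - - expR (- (dl * j%:R))).
  apply: ler_sum => j _; rewrite opprK [leRHS]addrC.
  have -> : - (dl * j%:R) = dl + - (dl * j.+1%:R) by rewrite -natr1; ring.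
  rewrite expRD -[X in _ - X]mul1r -mulrBl ler_wpM2r ?expR_ge0//.
  by have := expR_ge1Dx dl; lra.
move=> /le_trans; apply; rewrite telescope_sumr// mulr0 oppr0 expR0 opprK.
by rewrite gerDr oppr_le0 expR_ge0.
Qed.

Lemma sum_grid_expRN_le dl M : 0 < dl <= 1 ->
  \sum_(x <- grid dl M) dl * expR (- `|x|) <= 3.
Proof.
move=> /andP[dl0 dl1]; have dl_ge0 := ltW dl0.
have absE j : `|dl * j%:R| = dl * j%:R by rewrite ger0_norm// mulr_ge0.
rewrite sum_grid_split big_split /=.
under eq_bigr do rewrite normrN absE.
suff : \sum_(0 <= j < M) dl * expR (- `|dl * j%:R|) <= 2.
  by have := sum_expRN_le1 M dl0; lra.
under eq_bigr do rewrite absE.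
case: M => [|M]; first by rewrite big_geq.
rewrite big_nat_recl// mulr0 oppr0 expR0 mulr1.
by have := sum_expRN_le1 M dl0; lra.
Qed.

End Grid.

(** * Gaussian sums along a complex line *)

Section ComplexGaussian.
Variable R : realType.
Implicit Types (x r t : R) (A d k z : R[i]).

Definition cgauss z : R[i] := cexp (- z ^+ 2).

Lemma cgauss_real x : cgauss x%:C%C = (gauss_fun x)%:C%C.
Proof. by rewrite /cgauss -rmorphXn -rmorphN cexp_real. Qed.

Lemma normc_cgauss z : normc (cgauss z) = expR (- complex.Re (z ^+ 2)).
Proof. by rewrite normc_cexp -[- z ^+ 2]add0r ReB add0r. Qed.

Lemma normc_cgauss_le z : normc (cgauss z) <= expR (normc z ^+ 2).
Proof. by rewrite (le_trans (normc_cexp_le _))// normcN normcX. Qed.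

(* [d * cgauss z - 2 A k z cgauss z] is the derivative at [t = 0] of
   [(A + t d) cgauss (z + t k)]. *)
Lemma cgauss_shiftE A d k z (T : R[i]) :
  let v := - (T * (2 * z * k + T * k ^+ 2)) in
  (A + T * d) * cgauss (z + T * k) - A * cgauss z
    - T * ((d - 2 * A * k * z) * cgauss z) =
  cgauss z *
    (T * d * v - T ^+ 2 * (A * k ^+ 2) + (A + T * d) * (cexp v - 1 - v)).
Proof.
move=> v; have -> : cgauss (z + T * k) = cgauss z * cexp v.
  by rewrite /cgauss -cexpD; congr cexp; rewrite /v; ring.
by move: (cexp v) => e; rewrite /v; ring.
Qed.

Definition cgauss_remainder r : R := 24 * expR (2 * r).

Lemma cgauss_remainder_ge0 r : 0 <= cgauss_remainder r.
Proof. by rewrite mulr_ge0 ?expR_ge0. Qed.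

Lemma cgauss_remainder_ge r : 1 <= r ->
  2 * (r ^+ 2 + r ^+ 3 * expR r) <= cgauss_remainder r.
Proof.
move=> r1; have r0 : 0 <= r := le_trans ler01 r1.
rewrite /cgauss_remainder [2 * r]mulr_natl mulr2n expRD.
have expR_ge1 : 1 <= expR r by apply: le_trans (expR_ge1Dx r); lra.
have : r ^+ 2 * 1 <= r ^+ 3 * expR r.
  by apply: ler_pM; rewrite ?exprn_ge0// ler_weXn2l.
have : r ^+ 3 * expR r <= 6 * expR r * expR r.
  rewrite ler_wpM2r ?expR_ge0//; have := expR_ge1Dxn 2 r0.
  by rewrite (_ : 3`! = 6%N)//; lra.
by lra.
Qed.

Lemma cgauss_taylor1_le A d k z t r : 0 <= t <= 1 -> 1 <= r ->
  normc A <= r -> normc d <= r -> normc k ^+ 2 <= r ->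
  normc (2 * z * k + t%:C%C * k ^+ 2) <= r ->
  normc ((A + t%:C%C * d) * cgauss (z + t%:C%C * k) - A * cgauss z
         - t%:C%C * ((d - 2 * A * k * z) * cgauss z))
  <= t ^+ 2 * (normc (cgauss z) * cgauss_remainder r).
Proof.
move=> /andP[t0 t1] r1 Ar dr kr qr; have r0 : 0 <= r := le_trans ler01 r1.
rewrite cgauss_shiftE normcM [leRHS]mulrCA ler_wpM2l ?normc_ge0//.
set T := t%:C%C; set v := - _.
have nT : normc T = t by rewrite normc_real ger0_norm.
have vr : normc v <= t * r by rewrite normcN normcM nT ler_wpM2l.
have Tdr : normc (T * d) <= t * r by rewrite normcM nT ler_wpM2l.
have mixed_le : normc (T * d * v) <= t * r * (t * r).
  by rewrite normcM ler_pM ?normc_ge0.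
have quadratic_le : normc (T ^+ 2 * (A * k ^+ 2)) <= t ^+ 2 * (r * r).
  rewrite normcM normcX nT ler_wpM2l ?exprn_ge0// normcM normcX.
  by rewrite ler_pM ?exprn_ge0 ?normc_ge0.
have taylor_le : normc (cexp v - 1 - v) <= (t * r) ^+ 2 * expR r.
  rewrite (le_trans (normc_cexp_taylor1_le v))//.
  rewrite ler_pM ?exprn_ge0 ?normc_ge0 ?expR_ge0 ?ler_normcX//.
  by rewrite ler_expR (le_trans vr)// ler_piMl.
have remainder_le : normc ((A + T * d) * (cexp v - 1 - v)) <=
    (r + r) * ((t * r) ^+ 2 * expR r).
  rewrite normcM ler_pM ?normc_ge0// (le_trans (ler_normcD _ _))// lerD//.
  by rewrite (le_trans Tdr)// ler_piMl.
apply: le_trans (ler_normcD _ _) _.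
apply: le_trans (lerD (ler_normcB _ _) remainder_le) _.
apply: le_trans (lerD (lerD mixed_le quadratic_le) (lexx _)) _.
have -> : t * r * (t * r) + t ^+ 2 * (r * r)
    + (r + r) * ((t * r) ^+ 2 * expR r)
    = t ^+ 2 * (2 * (r ^+ 2 + r ^+ 3 * expR r)) by ring.
by rewrite ler_wpM2l ?sqr_ge0 ?cgauss_remainder_ge.
Qed.

End ComplexGaussian.

Section Contour.
Variables (R : realType) (w g : R[i]).
Implicit Types (s t x dl : R) (M : nat).

(* The line [x |-> contour s x] moves from the real axis at [s = 0] to
   [x |-> w x + g] at [s = 1]; [contour_dir s] and [contour_vel x] are the
   derivatives of [contour s x] in [x] and in [s]. *)
Definition contour_dir s : R[i] := 1 + s%:C%C * (w - 1).
Definition contour_vel x : R[i] := (w - 1) * x%:C%C + g.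
Definition contour s x : R[i] := contour_dir s * x%:C%C + s%:C%C * g.

Lemma contour_dirD s t : contour_dir (s + t) = contour_dir s + t%:C%C * (w - 1).
Proof. by rewrite /contour_dir rmorphD; ring. Qed.

Lemma contour_velD x t : contour_vel (x + t) = contour_vel x + t%:C%C * (w - 1).
Proof. by rewrite /contour_vel rmorphD; ring. Qed.

Lemma contourDs s t x :
  contour (s + t) x = contour s x + t%:C%C * contour_vel x.
Proof. by rewrite /contour contour_dirD /contour_vel rmorphD; ring. Qed.

Lemma contourDx s x t :
  contour s (x + t) = contour s x + t%:C%C * contour_dir s.
Proof. by rewrite /contour rmorphD; ring. Qed.

Lemma contour_dirE s : contour_dir s = (1 - s)%:C%C + s%:C%C * w.
Proof. by rewrite /contour_dir rmorphB rmorph1; ring. Qed.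

(* Both [s |-> contour_dir s * cgauss (contour s x)] and
   [x |-> contour_vel x * cgauss (contour s x)] have this derivative: this is
   Cauchy's theorem for the strip swept by the moving line. *)
Definition contour_drift s x : R[i] :=
  ((w - 1) - 2 * contour_dir s * contour_vel x * contour s x)
    * cgauss (contour s x).

Variables c kappa : R.
Hypothesis w_le : 1 + normc w <= c.
Hypothesis g_le : normc g <= c.
Hypothesis kappa_gt0 : 0 < kappa.
Hypothesis Re_dir_sqr_ge :
  forall s, 0 <= s <= 1 -> kappa <= complex.Re (contour_dir s ^+ 2).

Let c_ge1 : 1 <= c.
Proof. by apply: le_trans w_le; rewrite lerDl normc_ge0. Qed.

Let c_ge0 : 0 <= c. Proof. exact: le_trans ler01 c_ge1. Qed.

Let subr1_le : normc (w - 1) <= c.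
Proof. by rewrite (le_trans (ler_normcB _ _))// normc1 addrC. Qed.

Lemma contour_dir_le s : 0 <= s <= 1 -> normc (contour_dir s) <= c.
Proof.
move=> s01; have /andP[s0 s1] := s01; rewrite contour_dirE.
apply: le_trans (ler_normcD _ _) (le_trans (lerD _ _) w_le).
  by rewrite normc_real ger0_norm ?subr_ge0// gerBl.
exact: normc_realM_le.
Qed.

Lemma contour_vel_le x : normc (contour_vel x) <= c * (1 + `|x|).
Proof.
apply: le_trans (ler_normcD _ _) _.
by rewrite addrC mulrDr mulr1 lerD// normcM normc_real ler_wpM2r.
Qed.

Lemma contour_le s x : 0 <= s <= 1 -> normc (contour s x) <= c * (1 + `|x|).
Proof.
move=> s01; apply: le_trans (ler_normcD _ _) _.
rewrite addrC mulrDr mulr1 lerD//.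
  exact: le_trans (normc_realM_le g s01) g_le.
by rewrite normcM normc_real ler_wpM2r// contour_dir_le.
Qed.

Lemma Re_sqr_contour_ge s x : 0 <= s <= 1 ->
  kappa * x ^+ 2 - 2 * c ^+ 2 * `|x| - c ^+ 2 <= complex.Re (contour s x ^+ 2).
Proof.
move=> s01; set V := contour_dir s; set G := s%:C%C * g.
have V_le : normc V <= c := contour_dir_le s01.
have G_le : normc G <= c := le_trans (normc_realM_le g s01) g_le.
have -> : contour s x ^+ 2 =
    (x ^+ 2)%:C%C * V ^+ 2 - - (2 * (x%:C%C * (V * G)) + G ^+ 2).
  by rewrite /contour -/V -/G rmorphXn /=; ring.
have -> : kappa * x ^+ 2 - 2 * c ^+ 2 * `|x| - c ^+ 2 =
    x ^+ 2 * kappa - (2 * (`|x| * (c * c)) + c ^+ 2) by ring.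
rewrite ReB Re_realM lerB//; first by rewrite ler_wpM2l ?sqr_ge0 ?Re_dir_sqr_ge.
apply: le_trans (ler_norm _) (le_trans (ler_Re_normc _) _); rewrite normcN.
apply: le_trans (ler_normcD _ _) (lerD _ _).
  by rewrite 3!normcM normc_nat normc_real !ler_wpM2l// ler_pM ?normc_ge0.
by rewrite normcX ler_normcX.
Qed.

Definition contour_bound : R :=
  24 * expR ((8 * c ^+ 2 + 1) ^+ 2 / (4 * kappa) + 7 * c ^+ 2).

Lemma contour_bound_ge0 : 0 <= contour_bound.
Proof. by rewrite mulr_ge0 ?expR_ge0. Qed.

Lemma cgauss_contour_decay s x : 0 <= s <= 1 ->
  normc (cgauss (contour s x)) * cgauss_remainder (3 * c ^+ 2 * (1 + `|x|))
  <= contour_bound * expR (- `|x|).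
Proof.
move=> s01; rewrite normc_cgauss mulrCA -[leRHS]mulrA ler_wpM2l//.
rewrite -!expRD ler_expR; set a := 8 * c ^+ 2 + 1.
have complete_square :
    a * `|x| - kappa * x ^+ 2 <= a ^+ 2 / (4 * kappa).
  rewrite -subr_ge0 -[x ^+ 2]real_normK ?num_real//.
  have -> : a ^+ 2 / (4 * kappa) - (a * `|x| - kappa * `|x| ^+ 2) =
      kappa * (`|x| - a / (2 * kappa)) ^+ 2 by field; rewrite gt_eqF.
  by rewrite mulr_ge0 ?sqr_ge0 ?ltW.
by have := Re_sqr_contour_ge x s01; move: complete_square; rewrite /a; lra.
Qed.

Lemma normc_vel_cgauss_le s x : 0 <= s <= 1 ->
  normc (contour_vel x * cgauss (contour s x)) <= contour_bound * expR (- `|x|).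
Proof.
move=> s01; apply: le_trans (cgauss_contour_decay x s01).
rewrite normcM mulrC ler_wpM2l ?normc_ge0// (le_trans (contour_vel_le x))//.
set y := 1 + `|x|; have y0 : 0 <= y by rewrite addr_ge0.
have : c * y <= c ^+ 2 * y by rewrite ler_wpM2r// expr2 ler_peMr.
have := expR_ge1Dx (2 * (3 * c ^+ 2 * y)).
have : 0 <= c ^+ 2 * y by rewrite mulr_ge0 ?sqr_ge0.
by rewrite /cgauss_remainder; lra.
Qed.

Definition contour_ds_bound x : R :=
  expR ((c * (1 + `|x|)) ^+ 2) * cgauss_remainder (3 * (c * (1 + `|x|)) ^+ 2).

Lemma contour_drift_ds_le s t x : 0 <= s <= 1 -> 0 <= t <= 1 ->
  normc (contour_dir (s + t) * cgauss (contour (s + t) x)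
         - contour_dir s * cgauss (contour s x) - t%:C%C * contour_drift s x)
  <= t ^+ 2 * contour_ds_bound x.
Proof.
move=> s01 t01; rewrite /contour_ds_bound; set y := c * (1 + `|x|).
have cy : c <= y by rewrite ler_peMr// lerDl.
have y1 : 1 <= y := le_trans c_ge1 cy.
have yy : y <= y ^+ 2 by rewrite expr2 ler_peMr// (le_trans _ y1).
have y_le : y <= 3 * y ^+ 2 by have := sqr_ge0 y; lra.
have z_le : normc (contour s x) <= y := contour_le x s01.
have k_le : normc (contour_vel x) <= y := contour_vel_le x.
rewrite contour_dirD contourDs /contour_drift.
apply: le_trans (cgauss_taylor1_le t01 (le_trans y1 y_le) _ _ _ _) _.
- exact: le_trans (contour_dir_le s01) (le_trans cy y_le).
- exact: le_trans subr1_le (le_trans cy y_le).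
- by apply: le_trans (ler_normcX 2 k_le) _; have := sqr_ge0 y; lra.
- by apply: le_trans (normc_sqr_shift_le t01 z_le k_le) _; rewrite -expr2; lra.
rewrite ler_wpM2l ?sqr_ge0// ler_wpM2r ?cgauss_remainder_ge0//.
by apply: le_trans (normc_cgauss_le _) _; rewrite ler_expR ler_normcX.
Qed.

Lemma contour_drift_dx_le s x dl : 0 <= s <= 1 -> 0 <= dl <= 1 ->
  normc (contour_vel (x + dl) * cgauss (contour s (x + dl))
         - contour_vel x * cgauss (contour s x) - dl%:C%C * contour_drift s x)
  <= dl ^+ 2 * (contour_bound * expR (- `|x|)).
Proof.
move=> s01 dl01; have c1 := c_ge1.
set y := 1 + `|x|; have y1 : 1 <= y by rewrite lerDl.
have c2 : c <= c ^+ 2 by rewrite expr2 ler_peMr.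
have c2y : c ^+ 2 <= c ^+ 2 * y by rewrite ler_peMr ?sqr_ge0.
have cy : c * y <= c ^+ 2 * y by rewrite ler_wpM2r// (le_trans _ y1).
have z_le := contour_le x s01; have k_le := contour_dir_le s01.
rewrite contour_velD contourDx.
have -> : contour_drift s x =
    ((w - 1) - 2 * contour_vel x * contour_dir s * contour s x)
      * cgauss (contour s x) by rewrite /contour_drift; ring.
apply: le_trans (cgauss_taylor1_le (r := 3 * c ^+ 2 * y) dl01 _ _ _ _ _) _.
- by lra.
- by apply: le_trans (contour_vel_le x) _; rewrite -/y; lra.
- by apply: le_trans subr1_le _; lra.
- by apply: le_trans (ler_normcX 2 k_le) _; lra.
- by apply: le_trans (normc_sqr_shift_le dl01 z_le k_le) _; rewrite -/y; lra.
by rewrite ler_wpM2l ?sqr_ge0 ?cgauss_contour_decay.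
Qed.

(* Summed over the grid, the derivative in [x] telescopes. *)
Lemma sum_contour_drift_le s dl M : 0 <= s <= 1 -> 0 < dl <= 1 ->
  normc (\sum_(x <- grid dl M) dl%:C%C * contour_drift s x)
  <= contour_bound * (3 * dl + 2 * expR (- (dl * M%:R))).
Proof.
move=> s01 dl01; have /andP[/ltW dl0 dl1] := dl01; set B := contour_bound.
pose Q x := contour_vel x * cgauss (contour s x).
have -> : \sum_(x <- grid dl M) dl%:C%C * contour_drift s x =
    (Q (dl * M%:R) - Q (- (dl * M%:R))) -
    \sum_(x <- grid dl M) (Q (x + dl) - Q x - dl%:C%C * contour_drift s x).
  by rewrite -telescope_grid -sumrB; apply: eq_bigr => x _; rewrite subKr.
rewrite [3 * dl + _]addrC mulrDr; apply: le_trans (ler_normcB _ _) (lerD _ _).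
  apply: le_trans (ler_normcB _ _) _.
  have Q_le y : normc (Q y) <= B * expR (- `|y|) := normc_vel_cgauss_le y s01.
  apply: le_trans (lerD (Q_le _) (Q_le _)) _.
  by rewrite normrN ger0_norm ?mulr_ge0// -/B; lra.
apply: le_trans (ler_normc_sum _ _ _) _.
apply: (@le_trans _ _ (B * dl * \sum_(x <- grid dl M) dl * expR (- `|x|))).
  rewrite mulr_sumr; apply: ler_sum => x _.
  rewrite (le_trans (contour_drift_dx_le _ s01 _)) ?dl0//.
  by rewrite /B; lra.
have := sum_grid_expRN_le M dl01.
have Bdl : 0 <= B * dl by rewrite mulr_ge0// contour_bound_ge0.
by move=> /(ler_wpM2l Bdl); lra.
Qed.

Lemma contour_deformation_le dl M : 0 < dl <= 1 ->
  normc (\sum_(x <- grid dl M) dl%:C%C * (w * cgauss (w * x%:C%C + g)) -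
         \sum_(x <- grid dl M) dl%:C%C * cgauss x%:C%C)
  <= contour_bound * (3 * dl + 2 * expR (- (dl * M%:R))).
Proof.
move=> dl01; have /andP[/ltW dl0 _] := dl01.
pose f s x := contour_dir s * cgauss (contour s x).
pose Phi s := \sum_(x <- grid dl M) dl%:C%C * f s x.
have -> : \sum_(x <- grid dl M) dl%:C%C * (w * cgauss (w * x%:C%C + g)) = Phi 1.
  by apply: eq_bigr => x _; rewrite /f /contour /contour_dir !mul1r subrKC.
have -> : \sum_(x <- grid dl M) dl%:C%C * cgauss x%:C%C = Phi 0.
  apply: eq_bigr => x _.
  by rewrite /f /contour /contour_dir !mul0r !addr0 !mul1r.
set e := contour_bound * _; have -> : e = (1 - 0) * e by rewrite subr0 mul1r.
apply: (normc_increment_le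
  (K := \sum_(x <- grid dl M) dl * contour_ds_bound x)) => // s t s0 t0 st1.
have s01 : 0 <= s <= 1 by lra.
have -> : Phi (s + t) - Phi s =
    t%:C%C * (\sum_(x <- grid dl M) dl%:C%C * contour_drift s x) +
    \sum_(x <- grid dl M)
      dl%:C%C * (f (s + t) x - f s x - t%:C%C * contour_drift s x).
  by rewrite mulr_sumr -sumrB -big_split; apply: eq_bigr => x _ /=; ring.
apply: le_trans (ler_normcD _ _) (lerD _ _).
  by rewrite normcM normc_real ger0_norm// ler_wpM2l// sum_contour_drift_le.
apply: le_trans (ler_normc_sum _ _ _) _.
rewrite mulr_sumr; apply: ler_sum => x _.
rewrite normcM normc_real ger0_norm// [leRHS]mulrCA ler_wpM2l//.
by apply: contour_drift_ds_le; lra.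
Qed.

End Contour.

Lemma Re_contour_dir_sqr_ge (R : realType) (w : R[i]) :
  `|complex.Im w| < complex.Re w ->
  exists2 kappa : R, 0 < kappa & forall s, 0 <= s <= 1 ->
    kappa <= complex.Re (contour_dir w s ^+ 2).
Proof.
case: w => p q pq; have /andP[Nq_lt q_lt] : - p < q < p by rewrite -ltr_norml.
pose m := Num.min 1 (Num.min (p - q) (p + q)).
have m_gt0 : 0 < m by rewrite !lt_min; lra.
have [m_le1 m_leB m_leD] : [/\ m <= 1, m <= p - q & m <= p + q].
  by rewrite !ge_min !lexx !orbT.
exists (m ^+ 2) => [|s /andP[s0 s1]]; first exact: exprn_gt0.
have -> : complex.Re (contour_dir (p +i* q)%C s ^+ 2) =
    ((1 - s) * 1 + s * (p - q)) * ((1 - s) * 1 + s * (p + q)).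
  by rewrite expr2 /=; ring.
have ge_m u : m <= u -> m <= (1 - s) * 1 + s * u.
  move=> mu; rewrite -[m]mul1r -{1}(subrK s 1) mulrDl.
  by rewrite lerD// ler_wpM2l// subr_ge0.
by rewrite expr2 ler_pM ?(ltW m_gt0) ?ge_m.
Qed.

Section DecreasingRiemannSum.
Variables (R : realType) (f : R -> R).
Hypothesis f_cont : continuous f.
Hypothesis f_noninc : forall x y, 0 <= x -> x <= y -> f y <= f x.
Implicit Types (x dl : R) (M : nat).

Local Notation mu := (@lebesgue_measure R).
Local Notation If x := (\int[mu]_(t in `[0, x]) f t).

Let integrable_itv (h : R -> R) x y : continuous h ->
  mu.-integrable `[x, y]%classic (EFin \o h).
Proof.
move=> hc; apply: continuous_compact_integrable; first exact: segment_compact.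
exact: continuous_subspaceT.
Qed.

Lemma Rintegral_step_bounds x dl : 0 <= x -> 0 < dl ->
  dl * f (x + dl) <= If (x + dl) - If x <= dl * f x.
Proof.
move=> x0 dl0; have xdl : x < x + dl by rewrite ltrDl.
rewrite Rintegral_itvB ?bnd_simp ?(ltW xdl)//; last exact: integrable_itv.
have ioc (h : R -> R) : continuous h ->
    mu.-integrable `]x, x + dl]%classic (EFin \o h).
  move=> hc; apply: integrableS (integrable_itv x (x + dl) hc) => //.
  exact: subset_itv_oc_cc.
have icst (r : R) : \int[mu]_(_ in `]x, (x + dl)]) r = dl * r.
  rewrite Rintegral_cst// [X in fine X]lebesgue_measure_itv /= lte_fin xdl.
  by rewrite -EFinB addrAC subrr add0r mulrC.
have cst_cont (r : R) : continuous (cst r : R -> R) by move=> ?; apply: cvg_cst.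
apply/andP; split; rewrite -icst; apply: le_Rintegral => //.
- exact: ioc (cst_cont _).
- exact: ioc.
- move=> t /=; rewrite in_itv /= => /andP[xt tx]; apply: f_noninc => //.
  exact: le_trans x0 (ltW xt).
- exact: ioc.
- exact: ioc (cst_cont _).
- by move=> t /=; rewrite in_itv /= => /andP[/ltW xt _]; apply: f_noninc.
Qed.

Lemma Rintegral_sum_bounds dl M : 0 < dl ->
  \sum_(0 <= j < M) dl * f (dl * j.+1%:R) <= If (dl * M%:R)
  <= \sum_(0 <= j < M) dl * f (dl * j%:R).
Proof.
move=> dl0; elim: M => [|M /andP[lo hi]].
  by rewrite !big_geq// mulr0 set_itv1 Rintegral_set1 lexx.
rewrite !big_nat_recr//= -natr1 mulrDr mulr1.
have := @Rintegral_step_bounds (dl * M%:R) dl.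
by rewrite mulr_ge0 ?(ltW dl0)// => /(_ isT dl0); lra.
Qed.

Lemma sum_grid_Rintegral_le dl M : 0 < dl ->
  (forall x, f (- x) = f x) -> (forall x, 0 <= f x) ->
  `|\sum_(x <- grid dl M) dl * f x - 2 * If (dl * M%:R)| <= dl * f 0.
Proof.
move=> dl0 f_even f_ge0; rewrite sum_grid_split big_split /=.
under eq_bigr do rewrite f_even.
have := Rintegral_sum_bounds M dl0.
set U := \sum_(0 <= j < M) dl * f (dl * j.+1%:R).
set V := \sum_(0 <= j < M) dl * f (dl * j%:R).
have : V - U <= dl * f 0.
  rewrite -opprB -sumrB (telescope_sumr (fun j => dl * f (dl * j%:R)))//.
  by rewrite mulr0 opprB gerBl mulr_ge0// ltW.
by move=> UV_le /andP[U_le V_ge]; rewrite ler_norml; lra.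
Qed.

End DecreasingRiemannSum.

Lemma cvg_integral0_gauss (R : realType) :
  gauss_integral_proof.integral0_gauss x @[x --> +oo] --> (Num.sqrt pi / 2 : R).
Proof.
have -> : gauss_integral_proof.integral0_gauss =
    (fun x : R => Num.sqrt (gauss_integral_proof.integral0_gauss x ^+ 2)).
  apply/funext => x; rewrite sqrtr_sqr ger0_norm//.
  exact: gauss_integral_proof.integral0_gauss_ge0.
have -> : Num.sqrt pi / 2 = Num.sqrt (pi / 4) :> R.
  rewrite sqrtrM ?pi_ge0// -{1}(ger0_norm (ler0n R 2)) -sqrtr_sqr.
  by rewrite sqrtrV ?sqr_ge0// -natrX.
exact: continuous_cvg (@sqrt_continuous R _)
  gauss_integral_proof.cvg_integral0_gauss_sqr.
Qed.

Section GaussianSumLimit.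
Context {R : realType} {T : Type} {F : set_system T} {FF : Filter F}.
Variables (dl : T -> R) (M : T -> nat).
Hypothesis dl_gt0 : \forall t \near F, 0 < dl t.
Hypothesis dl_cvg0 : dl @ F --> (0 : R).
Hypothesis range_cvgy : dl t * (M t)%:R @[t --> F] --> +oo.

Lemma cvg_sum_grid_gauss :
  \sum_(x <- grid (dl t) (M t)) dl t * gauss_fun x @[t --> F] -->
    (Num.sqrt pi : R).
Proof.
pose I t := 2 * gauss_integral_proof.integral0_gauss (dl t * (M t)%:R).
have I_cvg : I @ F --> (Num.sqrt pi : R).
  have -> : Num.sqrt pi = 2 * (Num.sqrt pi / 2) :> R by rewrite mulrC divfK.
  exact: cvgM (cvg_cst _) (cvg_comp _ _ range_cvgy (@cvg_integral0_gauss R)).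
apply: cvg_sub0 I_cvg; apply/norm_cvg0P.
apply: squeeze_cvgr (cvg_cst 0) dl_cvg0.
apply: filterS dl_gt0 => t dlt; rewrite normr_ge0 /=.
have gauss0 : gauss_fun 0 = 1 :> R by rewrite /gauss_fun expr0n oppr0 expR0.
rewrite -[leRHS]mulr1 -gauss0; apply: sum_grid_Rintegral_le => //.
- exact: continuous_gauss_fun.
- move=> x y x0 xy; rewrite ler_expR lerN2 lerXn2r ?nnegrE//.
  exact: le_trans x0 xy.
- by move=> x; rewrite /gauss_fun sqrrN.
- exact: gauss_fun_ge0.
Qed.

Variables (w : R[i]) (g : T -> R[i]) (G : R).
Hypothesis w_cone : `|complex.Im w| < complex.Re w.
Hypothesis g_le : \forall t \near F, normc (g t) <= G.

Lemma cvg_sum_grid_cgauss :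
  \sum_(x <- grid (dl t) (M t)) (dl t)%:C%C * (w * cgauss (w * x%:C%C + g t))
    @[t --> F] --> ((Num.sqrt pi)%:C%C : R[i]).
Proof.
have [kappa kappa_gt0 kappa_le] := Re_contour_dir_sqr_ge w_cone.
set c := Num.max (1 + normc w) G.
have real_cvg : \sum_(x <- grid (dl t) (M t)) (dl t)%:C%C * cgauss x%:C%C
    @[t --> F] --> ((Num.sqrt pi)%:C%C : R[i]).
  have realE t : \sum_(x <- grid (dl t) (M t)) (dl t)%:C%C * cgauss x%:C%C =
      (\sum_(x <- grid (dl t) (M t)) dl t * gauss_fun x)%:C%C.
    rewrite rmorph_sum; apply: eq_bigr => x _ /=.
    by rewrite cgauss_real rmorphM.
  under eq_fun do rewrite realE.
  exact: cvg_real_complex cvg_sum_grid_gauss.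
apply: cvgc_normB0 real_cvg.
set B := contour_bound c kappa.
pose bound t := B * (3 * dl t + 2 * expR (- (dl t * (M t)%:R))).
have bound_cvg0 : bound @ F --> (0 : R).
  have exp_cvg0 : expR (- (dl t * (M t)%:R)) @[t --> F] --> (0 : R).
    exact: cvg_comp range_cvgy (@cvgr_expR R).
  have -> : 0 = B * (3 * 0 + 2 * 0) by rewrite !mulr0 addr0 mulr0.
  apply: cvgM (cvg_cst _) (cvgD _ _); first exact: cvgM (cvg_cst _) dl_cvg0.
  exact: cvgM (cvg_cst _) exp_cvg0.
apply: squeeze_cvgr (cvg_cst 0) bound_cvg0.
have dl_le1 : \forall t \near F, dl t <= 1 by apply: cvgr_le dl_cvg0 _ _.
apply: filterS3 dl_gt0 dl_le1 g_le => t dlt0 dlt1 gt.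
rewrite normc_ge0; apply: contour_deformation_le => //.
- by rewrite le_max lexx.
- by rewrite le_max gt orbT.
- by rewrite dlt0.
Qed.

End GaussianSumLimit.

(** * The fibres of [Cxi] *)

Lemma big_seq_sub (V : Type) (idx : V) (op : Monoid.com_law idx)
    (I : choiceType) (e : seq I) (F : I -> V) : uniq e ->
  \big[op/idx]_(x <- e) F x = \big[op/idx]_(i : seq_sub e) F (val i).
Proof.
move=> ue; rewrite -{1}(val_seq_sub_enum ue) big_map; apply: perm_big.
apply: uniq_perm; rewrite ?undup_uniq ?index_enum_uniq// => i.
by rewrite mem_seq_sub_enum mem_index_enum.
Qed.

Definition extended_funs (T U : Type) (u0 : U) (A : set T) (B : set U) :
    set (T -> U) :=
  [set a | (forall t, A t -> B (a t)) /\ (forall t, ~ A t -> a t = u0)].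

Section ExtendedFunctions.
Variables (T U : choiceType) (u0 : U) (s : seq T) (r : seq U).

Local Notation funs := (extended_funs u0 [set` s] [set` r]).

Definition extend_ffun (f : {ffun seq_sub s -> seq_sub r}) : T -> U :=
  fun t => oapp (fun i => val (f i)) u0 (insub t).

Lemma extend_ffunE f (i : seq_sub s) : extend_ffun f (val i) = val (f i).
Proof. by rewrite /extend_ffun valK. Qed.

Lemma extend_ffun_inj : injective extend_ffun.
Proof.
by move=> f g fg; apply/ffunP => i; apply/val_inj; rewrite -!extend_ffunE fg.
Qed.

Lemma extended_funsE : funs = range extend_ffun.
Proof.
apply/seteqP; split=> [a [aB a0]|_ [f _ <-]]; last first.
  split=> [t /= ts|t /negP nts]; last by rewrite /extend_ffun insubN.
  by rewrite -[t]/(val (SeqSub ts)) extend_ffunE; apply: valP.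
exists [ffun i => SeqSub (aB _ (valP i))] => //; apply/funext => t.
rewrite /extend_ffun; case: insubP => [i _ <-|/negP/a0->//].
by rewrite /= ffunE.
Qed.

Lemma finite_extended_funs : finite_set funs.
Proof.
by rewrite extended_funsE; apply: finite_image; apply: finite_finset.
Qed.

Lemma sum_extended_funs_prod (V : comNzRingType) (phi : T -> U -> V) :
  uniq s -> uniq r ->
  \sum_(a \in funs) \prod_(t <- s) phi t (a t) =
  \prod_(t <- s) \sum_(u <- r) phi t u.
Proof.
move=> us ur; rewrite extended_funsE fsbig_image; last first.
  by move=> f g _ _; apply: extend_ffun_inj.
rewrite [RHS]big_seq_sub//.
under [RHS]eq_bigr do rewrite big_seq_sub//.
rewrite bigA_distr_bigA [RHS]fsbig_seq ?index_enum_uniq//.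
rewrite (_ : [set` _] = setT); last first.
  by apply/seteqP; split=> // f _; apply: mem_index_enum.
apply: eq_fsbigr => f _; rewrite big_seq_sub//.
by apply: eq_bigr => i _; rewrite extend_ffunE.
Qed.

End ExtendedFunctions.

Section CxiFibre.
Variable R : realType.
Implicit Types (xi : R[i]) (h : R) (M : nat).

Definition Cxi_summand xi h h' M (b a : R -> R) : R[i] :=
  (h `^ (- (h ^+ 2) / 2) * h' `^ (- h ^+ 2))%:C%C *
  cexp (- (pi%:C%C * (h^-1)%:C%C * xi *
    \sum_(k \in [set` grid h^-1 M])
      ((a k)%:C%C + 'i%C * xi^-1 * (b k)%:C%C) ^+ 2)).

Definition Cxi_fibre xi h h' M M' (b : R -> R) : R[i] :=
  \sum_(a \in extended_funs 0 [set` grid h^-1 M] [set` grid h'^-1 M'])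
    Cxi_summand xi h h' M b a.

(* [Cxi_weight] and [Cxi_factor] are the contributions to [Cxi_summand] and to
   [Cxi_fibre] of a lattice point [k] with [a k = y] and [b k = beta]. *)
Definition Cxi_weight xi h h' (beta y : R) : R[i] :=
  ((Num.sqrt h)^-1 * h'^-1)%:C%C *
  cexp (- (pi%:C%C * (h^-1)%:C%C * xi *
           (y%:C%C + 'i%C * xi^-1 * beta%:C%C) ^+ 2)).

Definition Cxi_factor xi h h' M' (beta : R) : R[i] :=
  \sum_(y <- grid h'^-1 M') Cxi_weight xi h h' beta y.

Lemma Cxi_summand_prod xi h h' M b a : 0 < h -> 0 < h' ->
  M%:R * 2 = h ^+ 2 ->
  Cxi_summand xi h h' M b a =
  \prod_(k <- grid h^-1 M) Cxi_weight xi h h' (b k) (a k).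
Proof.
move=> h0 h'0 M2; rewrite /Cxi_summand -fsbig_seq; last first.
  by rewrite uniq_grid// invr_eq0 gt_eqF.
rewrite big_split /= mulr_sumr -sumrN cexp_sum; congr (_ * _).
rewrite big_const_seq count_predT size_grid iter_mulr_1 -rmorphXn.
congr (_%:C%C); rewrite exprMn; congr (_ * _).
  have -> : - h ^+ 2 / 2 = - 2^-1 * (M + M)%:R by rewrite -M2 natrD; field.
  by rewrite powRrM powR_mulrn ?powR_ge0// powRN powR12_sqrt// ltW.
have -> : - h ^+ 2 = -1 * (M + M)%:R by rewrite -M2 natrD; ring.
by rewrite powRrM powR_mulrn ?powR_ge0// powR_inv1// ltW.
Qed.

Lemma Cxi_fibre_prod xi h h' M M' b : 0 < h -> 0 < h' ->
  M%:R * 2 = h ^+ 2 ->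
  Cxi_fibre xi h h' M M' b =
  \prod_(k <- grid h^-1 M) Cxi_factor xi h h' M' (b k).
Proof.
move=> h0 h'0 M2; rewrite /Cxi_factor.
rewrite -(sum_extended_funs_prod 0 (fun k => Cxi_weight xi h h' (b k))).
- by apply: eq_fsbigr => a _; apply: Cxi_summand_prod.
- by rewrite uniq_grid// invr_eq0 gt_eqF.
- by rewrite uniq_grid// invr_eq0 gt_eqF.
Qed.

Lemma sqrtc_cone xi : 0 < complex.Re xi ->
  `|complex.Im (sqrtc xi)| < complex.Re (sqrtc xi).
Proof.
move=> xi0; have : 0 < complex.Re (sqrtc xi ^+ 2) by rewrite sqr_sqrtc.
have : 0 <= complex.Re (sqrtc xi) by case: (xi) => a b; apply: sqrtr_ge0.
case: (sqrtc xi) => p q /= p0; rewrite subr_gt0 -!expr2 => qp.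
by rewrite -(ger0_norm p0) -!sqrtr_sqr ltr_sqrt// (le_lt_trans _ qp)// sqr_ge0.
Qed.

(* Up to the factor [Cxi_scale], the sum [Cxi_factor] is a Riemann sum of
   [cgauss] along a line of direction [Cxi_dir]. *)
Definition Cxi_dir xi h : R[i] := sqrtc xi * (Num.sqrt (pi / h))%:C%C.
Definition Cxi_scale xi h : R[i] := ((Num.sqrt h)^-1)%:C%C / Cxi_dir xi h.

Lemma Cxi_dir_sqr xi h : 0 < h ->
  Cxi_dir xi h ^+ 2 = pi%:C%C * (h^-1)%:C%C * xi.
Proof.
move=> h0; rewrite exprMn sqr_sqrtc -rmorphXn sqr_sqrtr; last first.
  by rewrite divr_ge0 ?pi_ge0 ?ltW.
by rewrite rmorphM mulrC.
Qed.

Lemma Cxi_dir_neq0 xi h : xi != 0 -> 0 < h -> Cxi_dir xi h != 0.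
Proof.
move=> xi0 h0; rewrite -sqrf_eq0 Cxi_dir_sqr// !mulf_neq0//.
  by rewrite -(rmorph0 (real_complex R)) (inj_eq (@complexI R)) gt_eqF ?pi_gt0.
by rewrite -(rmorph0 (real_complex R)) (inj_eq (@complexI R)) invr_eq0 gt_eqF.
Qed.

Lemma Cxi_scale_sqrt_pi xi h : xi != 0 -> 0 < h ->
  Cxi_scale xi h * (Num.sqrt pi)%:C%C = 1 / sqrtc xi.
Proof.
move=> xi0 h0; apply: (mulIf (Cxi_dir_neq0 xi0 h0)).
rewrite mulrAC divfK ?Cxi_dir_neq0// /Cxi_dir mulrA divfK ?sqrtc_eq0//.
rewrite mul1r -rmorphM; congr (_%:C%C).
by rewrite sqrtrM ?pi_ge0// sqrtrV ?(ltW h0)// mulrC.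
Qed.

Lemma Cxi_factorE xi h h' M' beta : xi != 0 -> 0 < h ->
  Cxi_factor xi h h' M' beta = Cxi_scale xi h *
    \sum_(y <- grid h'^-1 M') (h'^-1)%:C%C * (Cxi_dir xi h *
      cgauss (Cxi_dir xi h * y%:C%C
              + Cxi_dir xi h * ('i%C * xi^-1 * beta%:C%C))).
Proof.
move=> xi0 h0; rewrite /Cxi_factor mulr_sumr; apply: eq_bigr => y _.
rewrite /Cxi_weight -mulrDr /cgauss exprMn Cxi_dir_sqr// rmorphM -[LHS]mulrA.
rewrite /Cxi_scale [in RHS](mulrCA _ (Cxi_dir xi h)) [RHS]mulrA.
by rewrite divfK ?Cxi_dir_neq0.
Qed.

Context {T : Type} {F : set_system T} {FF : Filter F}.
Variables (xi : R[i]) (h b0 : R) (h' : T -> R) (M' : T -> nat).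
Hypothesis xi_gt0 : 0 < complex.Re xi.
Hypothesis h_gt0 : 0 < h.
Hypothesis h'_cvgy : h' @ F --> +oo.
Hypothesis M'_eq : \forall t \near F, (M' t)%:R * 2 = h * h' t ^+ 2.

Let xi_neq0 : xi != 0.
Proof. by apply/eqP => xi0; move: xi_gt0; rewrite xi0 ltxx. Qed.

Let h'_gt0 : \forall t \near F, 0 < h' t.
Proof. by have /cvgryPgt := h'_cvgy; apply. Qed.

Lemma cvg_Cxi_factor (beta : T -> R) :
  (\forall t \near F, `|beta t| <= b0) ->
  Cxi_factor xi h (h' t) (M' t) (beta t) @[t --> F] --> 1 / sqrtc xi.
Proof.
move=> beta_le.
rewrite -(Cxi_scale_sqrt_pi xi_neq0 h_gt0).
under eq_fun do rewrite Cxi_factorE//.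
apply: cvgM (cvg_cst _) (cvg_sum_grid_cgauss (G := normc (Cxi_dir xi h) *
  (normc ('i%C * xi^-1) * b0)) _ _ _ _ _).
- by apply: filterS h'_gt0 => t; rewrite invr_gt0.
- exact/gtr0_cvgV0.
- have h2_gt0 : 0 < h / 2 by rewrite divr_gt0.
  apply: cvg_trans (cvg_comp _ _ h'_cvgy (gt0_cvgMry h2_gt0 cvg_id)).
  apply: near_eq_cvg; apply: filterS2 h'_gt0 M'_eq => t h't0 M'E.
  have -> : (M' t)%:R = h * h' t ^+ 2 / 2 by rewrite -M'E mulfK.
  by rewrite /=; field; rewrite gt_eqF.
- have := sqrtc_cone xi_gt0; rewrite /Cxi_dir; case: (sqrtc xi) => p q /= qp.
  have r_gt0 : 0 < Num.sqrt (pi / h) by rewrite sqrtr_gt0 divr_gt0 ?pi_gt0.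
  by rewrite !mulr0 subr0 add0r normrM (gtr0_norm r_gt0) ltr_pM2r.
- apply: filterS beta_le => t beta_t; rewrite normcM ler_wpM2l ?normc_ge0//.
  by rewrite normcM normc_real ler_wpM2l ?normc_ge0.
Qed.

Lemma cvg_Cxi_fibre (M : nat) (b : T -> R -> R) : M%:R * 2 = h ^+ 2 ->
  (\forall t \near F, forall k, k \in grid h^-1 M -> `|b t k| <= b0) ->
  Cxi_fibre xi h (h' t) M (M' t) (b t) @[t --> F] -->
    (1 / sqrtc xi) ^+ (M + M).
Proof.
move=> M2 b_le.
have prod_cvg : \prod_(k <- grid h^-1 M) Cxi_factor xi h (h' t) (M' t) (b t k)
    @[t --> F] --> (1 / sqrtc xi) ^+ (M + M).
  have -> : (1 / sqrtc xi) ^+ (M + M) = \prod_(k <- grid h^-1 M) (1 / sqrtc xi).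
    by rewrite big_const_seq count_predT size_grid iter_mulr_1.
  rewrite big_seq.
  under eq_fun do rewrite big_seq.
  apply: cvg_big => [|k kM]; first exact: mul_continuous.
  by apply: cvg_Cxi_factor; apply: filterS b_le => t; apply.
apply: cvg_trans prod_cvg; apply: near_eq_cvg; apply: filterS h'_gt0 => t h't0.
by rewrite Cxi_fibre_prod.
Qed.

End CxiFibre.

(** * Internal sets and standard parts *)

Section InternalSets.
Variables (I : Type) (F : ultrafilter I).

(* A choice of witnesses in the fibres is a single internal witness. *)
Lemma near_exists (T : Type) (P : I -> T -> Prop) :
  (\forall i \near uf_sets F, exists t, P i t) <->
  exists t : I -> T, \forall i \near uf_sets F, P i (t i).
Proof.
split=> [exP|[t]]; last by apply: filterS => i Pt; exists (t i).
have [i0 [t0 _]] := filter_ex exP.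
have /choice[t tP] i : exists t, (exists u, P i u) -> P i t.
  by have [[u Pu]|nP] := pselect (exists u, P i u); [exists u|exists t0].
by exists t; apply: filterS exP.
Qed.

Lemma near_forall (T : Type) (P : I -> T -> Prop) :
  (forall t : I -> T, \forall i \near uf_sets F, P i (t i)) ->
  \forall i \near uf_sets F, forall t, P i t.
Proof.
move=> allP; apply: contrapT => /uf_not nP.
have /near_exists[t nPt] : \forall i \near uf_sets F, exists t, ~ P i t.
  by apply: filterS nP => i /existsNP.
by have [i []] := uf_meet nPt (allP t).
Qed.

Lemma near_imply (P Q : I -> Prop) :
  (\forall i \near uf_sets F, P i -> Q i) <->
  ((\forall i \near uf_sets F, P i) -> \forall i \near uf_sets F, Q i).
Proof.
split=> [PQ FP|PQ]; first by apply: filterS2 PQ FP => i; apply.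
have [/PQ|/uf_not] := pselect (\forall i \near uf_sets F, P i).
  by apply: filterS.
by apply: filterS => i /=.
Qed.

Lemma near_all_seq (T : eqType) (s : seq T) (P : T -> I -> Prop) :
  (forall t, t \in s -> \forall i \near uf_sets F, P t i) ->
  \forall i \near uf_sets F, forall t, t \in s -> P t i.
Proof.
elim: s => [|u s IHs] sP; first by apply: filterE.
have uP : \forall i \near uf_sets F, P u i by apply: sP; rewrite mem_head.
have /IHs : forall t, t \in s -> \forall i \near uf_sets F, P t i.
  by move=> t ts; apply: sP; rewrite inE ts orbT.
by apply: filterS2 uP => i ui si t; rewrite inE => /predU1P[->//|/si].
Qed.

Lemma unat_ucl (T : comNzRingType) (n : nat) :
  n%:R = ucl F (fun=> n%:R : T).
Proof.
elim: n => [//|n IHn]; rewrite -natr1 IHn uadd_ucl.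
by apply/uclP/filterE => i /=; rewrite natr1.
Qed.

Lemma hR_ucl (R : realType) (z : I -> int) :
  hR R (ucl F z) = ucl F (fun i => (z i)%:~R).
Proof. exact: umapE. Qed.

Lemma uext_extended_funs (T U : Type) (u0 : U) (A : I -> set T)
    (B : I -> set U) :
  [set a : ultrapower F (T -> U) |
    (forall k, uext (ucl F A) k -> uext (ucl F B) (uapp a k)) /\
    (forall k, ~ uext (ucl F A) k -> uapp a k = ucst F u0)] =
  uext (ucl F (fun i => extended_funs u0 (A i) (B i))).
Proof.
apply/seteqP; split; elim/uclW=> a; rewrite /mkset.
  move=> [aB a0]; apply/uext_ucl; apply: filterI; apply: near_forall => k;
    apply/near_imply.
  - by move=> /uext_ucl/aB; rewrite uapp_ucl => /uext_ucl.
  - move=> /uf_not nAk; apply/uclP; rewrite -uapp_ucl; apply: a0.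
    by move=> /uext_ucl.
move=> /uext_ucl aAB; split; elim/uclW=> k; rewrite uapp_ucl.
  move=> /uext_ucl Ak; apply/uext_ucl.
  by apply: filterS2 aAB Ak => i [aB _]; apply: aB.
move=> nAk; apply/uclP.
have /uf_not : ~ \forall i \near uf_sets F, A i (k i) by move=> /uext_ucl.
by apply: filterS2 aAB => i [_ a0]; apply: a0.
Qed.

Lemma uext_grid (R : realType) (dl B : I -> R) (M : I -> nat) :
  (\forall i \near uf_sets F, 0 < dl i /\ dl i * (M i)%:R = B i) ->
  [set x | exists z : ultrapower F int,
     x = ucl F dl * hR R z /\ - ucl F B <= x < ucl F B] =
  uext (ucl F (fun i => [set` grid (dl i) (M i)])).
Proof.
move=> FB; apply/seteqP; split; elim/uclW=> x; rewrite /mkset.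
  move=> [+ []]; elim/uclW=> z; rewrite hR_ucl umul_ucl uopp_ucl.
  move=> /uclP xz /andP[/ule_ucl lo /ult_ucl hi]; apply/uext_ucl.
  apply: filterS2 (filterI xz FB) (filterI lo hi) => i [xi [d0 dB]] [li ui].
  by apply/gridP => //; exists (z i); rewrite dB; split=> //; apply/andP.
move=> /uext_ucl xg.
have /near_exists[z zP] : \forall i \near uf_sets F, exists z : int,
    x i = dl i * z%:~R /\ - B i <= x i < B i.
  by apply: filterS2 FB xg => i [d0 <-] /gridP; apply.
exists (ucl F z); rewrite hR_ucl umul_ucl uopp_ucl; split.
  by apply/uclP; apply: filterS zP => i [].
by apply/andP; split; [apply/ule_ucl|apply/ult_ucl];
  apply: filterS zP => i [_ /andP[]].
Qed.

Lemma hsum_ucl (T : choiceType) (V : zmodType) (S : I -> set T)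
    (f : I -> T -> V) (g : ultrapower F T -> ultrapower F V) :
  (forall i, finite_set (S i)) ->
  (forall x : I -> T, g (ucl F x) = ucl F (fun i => f i (x i))) ->
  hsum (uext (ucl F S)) g = ucl F (fun i => \sum_(t \in S i) f i t).
Proof.
move=> finS gE; apply: hsumE; exists S, f; split=> //.
by elim/uclW=> x _; rewrite gE uapp_ucl.
Qed.

End InternalSets.

Section DoubleUltrapower.
Variables (I1 I2 : Type) (F1 : ultrafilter I1) (F2 : ultrafilter I2).

Local Notation F12 := (uprod F1 F2).

Lemma near_uprod (P : I1 * I2 -> Prop) : (\forall p \near uf_sets F12, P p) <->
  \forall m \near uf_sets F2, \forall l \near uf_sets F1, P (l, m).
Proof. by []. Qed.

Lemma near_uprod_snd (P : I2 -> Prop) :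
  (\forall m \near uf_sets F2, P m) -> \forall p \near uf_sets F12, P p.2.
Proof.
by move=> FP; apply/near_uprod; apply: filterS FP => m Pm; apply: filterE.
Qed.

Lemma dstdE (T : Type) (t : T) : dstd F1 F2 t = ucl F12 (fun=> t).
Proof. exact: ustar_ucl. Qed.

Lemma ustar_set_uext (T : Type) (S : I2 -> set T) :
  (\forall m \near uf_sets F2, S m !=set0) ->
  ustar_set F1 (uext (ucl F2 S)) = uext (ucl F12 (fun p => S p.2)).
Proof.
move=> S0; apply/seteqP; split=> x.
  move=> [f [-> fS]]; apply/uext_ucl/near_uprod.
  have : \forall m \near uf_sets F2, forall l, S m (f (l, m)).
    by apply: near_forall => l; apply/uext_ucl.
  by apply: filterS => m Sf; apply: filterE.
elim/uclW: x => g /uext_ucl gS; have /near_exists[s sS] := S0.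
pose f p := if `[< S p.2 (g p) >] then g p else s p.2.
exists f; split.
  by apply/uclP; apply: filterS gS => q Sq; rewrite /f /= asboolT.
move=> l; apply/uext_ucl; apply: filterS sS => m Ss.
by rewrite /f /=; case: asboolP.
Qed.

Lemma near_ustar_seq (T : eqType) (s : I2 -> seq T) (P : I1 * I2 -> T -> Prop) :
  (forall k : I2 -> T, (\forall m \near uf_sets F2, k m \in s m) ->
     \forall p \near uf_sets F12, P p (k p.2)) ->
  \forall m \near uf_sets F2, \forall l \near uf_sets F1,
    forall t, t \in s m -> P (l, m) t.
Proof.
move=> sP.
have : \forall m \near uf_sets F2, forall t, t \in s m ->
    \forall l \near uf_sets F1, P (l, m) t.
  by apply: near_forall => k; apply/near_imply => /sP.
by apply: filterS => m /near_all_seq.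
Qed.

Lemma ustar_lt_cvgy (R : realType) (z' : I1 * I2 -> int) :
  (forall z : ultrapower F2 int, ustar F1 z < ucl F12 z') ->
  \forall m \near uf_sets F2,
    ((z' (l, m))%:~R : R) @[l --> uf_sets F1] --> +oo.
Proof.
move=> z'_inf.
have : \forall m \near uf_sets F2, forall n : int,
    \forall l \near uf_sets F1, n < z' (l, m).
  apply: near_forall => z; have := z'_inf (ucl F2 z).
  by rewrite ustar_ucl => /ult_ucl.
apply: filterS => m z'm; apply/cvgryPgt => a.
apply: filterS (z'm (Num.ceil a)) => l al.
by apply: le_lt_trans (ceil_ge a) _; rewrite ltr_int.
Qed.

Variable R : realType.
Implicit Types (C : I1 * I2 -> R[i]) (p : I2 -> R[i]).

Lemma hnormcB_ucl C (D : I1 * I2 -> R[i]) :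
  hnormc (ucl F12 C - ucl F12 D) = ucl F12 (fun k => normc (C k - D k)).
Proof. by rewrite usub_ucl /hnormc umapE. Qed.

Lemma ustar_near_cvgP C p :
  (forall d : ultrapower F2 R, 0 < d ->
     hnormc (ucl F12 C - ustar F1 (ucl F2 p)) < ustar F1 d) <->
  \forall m \near uf_sets F2, C (l, m) @[l --> uf_sets F1] --> p m.
Proof.
rewrite ustar_ucl hnormcB_ucl; split=> [Cp|Cp].
  have : \forall m \near uf_sets F2, forall e : R, 0 < e ->
      \forall l \near uf_sets F1, normc (C (l, m) - p m) < e.
    apply: near_forall => e; apply/near_imply => /ult_ucl/Cp.
    by rewrite ustar_ucl => /ult_ucl.
  by apply: filterS => m Cm; apply/cvgc_distP.
elim/uclW=> d /ult_ucl d0; rewrite ustar_ucl; apply/ult_ucl/near_uprod.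
by apply: filterS2 d0 Cp => m dm /cvgc_distP/(_ _ dm).
Qed.

Lemma st_ucl_cvg C p :
  (\forall m \near uf_sets F2, C (l, m) @[l --> uf_sets F1] --> p m) ->
  star_bounded (ucl F12 C) /\ st (ucl F12 C) = ucl F2 p.
Proof.
move=> Cp; split.
  exists (ucl F2 (fun m => normc (p m) + 1)).
  rewrite ustar_ucl /hnormc umapE; apply/ule_ucl/near_uprod.
  by apply: filterS Cp => m /cvgc_near_le.
apply: xget_unique; first exact/ustar_near_cvgP.
elim/uclW=> q /ustar_near_cvgP Cq; apply/uclP.
by apply: filterS2 Cq Cp => m /=; apply: cvg_unique; apply: norm_hausdorff.
Qed.

Lemma dstd_near_cvgP C (y : R[i]) :
  (forall d : R, 0 < d -> hnormc (ucl F12 C - dstd F1 F2 y) < dstd F1 F2 d) <->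
  C @ uf_sets F12 --> y.
Proof.
rewrite dstdE hnormcB_ucl; split=> [Cy|/cvgc_distP Cy d d0].
  by apply/cvgc_distP => e /Cy; rewrite dstdE => /ult_ucl.
by rewrite dstdE; apply/ult_ucl/Cy.
Qed.

Lemma bst_ucl_cvg C (y : R[i]) : C @ uf_sets F12 --> y ->
  std_bounded (ucl F12 C) /\ bst (ucl F12 C) = y.
Proof.
move=> Cy; split.
  exists (normc y + 1); rewrite dstdE /hnormc umapE.
  by apply/ule_ucl; apply: cvgc_near_le Cy.
apply: xget_unique; first exact/dstd_near_cvgP.
by move=> q /dstd_near_cvgP Cq; apply: cvg_unique Cq Cy; apply: norm_hausdorff.
Qed.

Lemma cvg_uprod_ratio C p :
  (\forall m \near uf_sets F2, C (l, m) @[l --> uf_sets F1] --> p m) ->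
  (\forall m \near uf_sets F2, p m != 0) ->
  C k / p k.2 @[k --> uf_sets F12] --> (1 : R[i]).
Proof.
move=> Cp p0; apply/cvgc_distP => e e0; apply/near_uprod.
apply: filterS2 p0 Cp => m pm0 Cm.
have /cvgc_distP : C (l, m) / p m @[l --> uf_sets F1] --> (1 : R[i]).
  by rewrite -[X in _ --> X](divff pm0); apply: cvgM Cm (cvg_cst _).
by apply.
Qed.

Lemma bst_ratio_cvg C p :
  (\forall m \near uf_sets F2, C (l, m) @[l --> uf_sets F1] --> p m) ->
  (\forall m \near uf_sets F2, p m != 0) ->
  let x := ucl F12 C / ustar F1 (ucl F2 p) in std_bounded x /\ bst x = 1.
Proof.
move=> Cp p0; rewrite /= ustar_ucl uinv_ucl umul_ucl.
exact: bst_ucl_cvg (cvg_uprod_ratio Cp p0).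
Qed.

End DoubleUltrapower.

(** * Representatives of [Cxi] *)

Definition pos_even (z : int) : Prop := 0 < z /\ exists k, z = 2 * k.

Lemma even_halfz (z : int) : 0 <= z -> (exists k, z = 2 * k) ->
  ((absz z)./2)%:Z * 2 = z.
Proof.
case: z => // n _ [k nk]; rewrite -PoszM muln2 even_halfK//.
by rewrite -[n]/(absz n%:Z) nk abszM oddM.
Qed.

Lemma near_pos_even (I : Type) (F : ultrafilter I) (h : I -> int) :
  0 < ucl F h -> (exists m, ucl F h = 2 * m) ->
  \forall i \near uf_sets F, pos_even (h i).
Proof.
move=> /ult_ucl h_gt0 [m]; elim/uclW: m => k.
rewrite unat_ucl umul_ucl => /uclP hk.
by apply: filterS2 h_gt0 hk => i hi_gt0 hik; split=> //; exists (k i).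
Qed.

Section CxiRepresentatives.
Variables (R : realType) (I1 I2 : Type).
Variables (F1 : ultrafilter I1) (F2 : ultrafilter I2).
Variables (h : I2 -> int) (h' : I1 * I2 -> int).

Local Notation F12 := (uprod F1 F2).
Local Notation H := (ucl F2 h).
Local Notation H' := (ucl F12 h').
Local Notation rh m := ((h m)%:~R : R).
Local Notation rh' p := ((h' p)%:~R : R).

(* Half the number of points of the fibres of [latL] and [latL']. *)
Definition halfL (m : I2) : nat := (absz (h m ^+ 2))./2.
Definition halfL' (p : I1 * I2) : nat := (absz (h p.2 * h' p ^+ 2))./2.

Lemma halfL_int m : pos_even (h m) -> (halfL m)%:Z * 2 = h m ^+ 2.
Proof.
move=> [h0 [k hk]]; apply: even_halfz; first exact: sqr_ge0.
by exists (k * h m); rewrite mulrA -hk expr2.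
Qed.

Lemma halfL_real m : pos_even (h m) -> (halfL m)%:R * 2 = rh m ^+ 2.
Proof. by move=> /halfL_int hL; rewrite -rmorphXn -hL rmorphM. Qed.

Lemma halfL'_real p : pos_even (h p.2) ->
  (halfL' p)%:R * 2 = rh p.2 * rh' p ^+ 2.
Proof.
move=> [h0 [k hk]]; have hL : (halfL' p)%:Z * 2 = h p.2 * h' p ^+ 2.
  apply: even_halfz; first by rewrite mulr_ge0 ?sqr_ge0// ltW.
  by exists (k * h' p ^+ 2); rewrite mulrA -hk.
by rewrite -rmorphXn -[RHS]rmorphM -hL rmorphM.
Qed.

Hypothesis h_even : \forall m \near uf_sets F2, pos_even (h m).
Hypothesis h'_gt0 : \forall p \near uf_sets F12, 0 < h' p.

Lemma sH_ucl : sH R F1 H = ucl F12 (fun p => rh p.2).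
Proof. by rewrite /sH ustar_ucl hR_ucl. Qed.

Lemma eps_ucl : eps R H = ucl F2 (fun m => (rh m)^-1).
Proof. by rewrite /eps hR_ucl uinv_ucl. Qed.

Lemma latL_uext :
  @latL R _ _ H = uext (ucl F2 (fun m => [set` grid (rh m)^-1 (halfL m)])).
Proof.
have bound_ucl : hR R H / 2 = ucl F2 (fun m => rh m / 2).
  by rewrite hR_ucl unat_ucl uinv_ucl umul_ucl.
rewrite /latL eps_ucl bound_ucl; apply: uext_grid.
apply: filterS h_even => m m_even; have [hm_gt0 _] := m_even.
rewrite invr_gt0 ltr0z; split=> //.
have -> : (halfL m)%:R = rh m ^+ 2 / 2 by rewrite -halfL_real// mulfK.
by field; rewrite intr_eq0 gt_eqF.
Qed.

Lemma latL'_uext : @latL' R _ _ _ _ H H' =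
  uext (ucl F12 (fun p => [set` grid (rh' p)^-1 (halfL' p)])).
Proof.
have bound_ucl :
    sH R F1 H * (hR R H' / 2) = ucl F12 (fun p => rh p.2 * (rh' p / 2)).
  rewrite sH_ucl hR_ucl unat_ucl uinv_ucl (umul_ucl F12 (fun p => rh' p)).
  by rewrite umul_ucl.
rewrite /latL' bound_ucl /eps' hR_ucl uinv_ucl; apply: uext_grid.
apply: filterS2 (near_uprod_snd F1 h_even) h'_gt0 => p p_even h'p_gt0.
rewrite invr_gt0 ltr0z; split=> //.
have -> : (halfL' p)%:R = rh p.2 * rh' p ^+ 2 / 2.
  by rewrite -halfL'_real// mulfK.
by field; rewrite intr_eq0 gt_eqF.
Qed.

Lemma starL_uext : @starL R _ _ F1 _ H =
  uext (ucl F12 (fun p => [set` grid (rh p.2)^-1 (halfL p.2)])).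
Proof.
rewrite /starL latL_uext.
rewrite (ustar_set_uext F1 (S := fun m => [set` grid (rh m)^-1 (halfL m)]))//.
apply: filterS h_even => m m_even; have [hm_gt0 _] := m_even.
have : size (grid (rh m)^-1 (halfL m)) != 0%N.
  rewrite size_grid; apply/eqP => size0.
  have := halfL_int m_even; rewrite mulr_natr mulr2n -PoszD size0 => /esym/eqP.
  by rewrite expf_eq0 /= gt_eqF.
by case: grid => // x s _; exists x; rewrite /= mem_head.
Qed.

Lemma Xset_uext : @Xset R _ _ _ _ H H' =
  uext (ucl F12 (fun p => extended_funs 0 [set` grid (rh p.2)^-1 (halfL p.2)]
                                          [set` grid (rh' p)^-1 (halfL' p)])).
Proof. by rewrite /Xset starL_uext latL'_uext; apply: uext_extended_funs. Qed.

Lemma eps0_ucl : eps0 R H H' = ucl F12 (fun p =>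
  (rh p.2) `^ (- (rh p.2 ^+ 2) / 2) * (rh' p) `^ (- rh p.2 ^+ 2)).
Proof.
rewrite /eps0 /hpowR sH_ucl uexp_ucl uopp_ucl unat_ucl uinv_ucl hR_ucl.
rewrite (umul_ucl F12 (fun p => - rh p.2 ^+ 2)).
rewrite (umap2E _ _ (fun p => rh p.2)) (umap2E _ _ (fun p => rh' p)).
by rewrite umul_ucl.
Qed.

Lemma hsum_starL_ucl (xi : R[i]) (a b : I1 * I2 -> R -> R) :
  hsum (@starL R _ _ F1 _ H) (fun k => (hC (uapp (ucl F12 a) k) +
    dstd F1 F2 ('i%C * xi^-1) * hC (uapp (ucl F12 b) k)) ^+ 2) =
  ucl F12 (fun p => \sum_(k \in [set` grid (rh p.2)^-1 (halfL p.2)])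
    ((a p k)%:C%C + 'i%C * xi^-1 * (b p k)%:C%C) ^+ 2).
Proof.
rewrite starL_uext; apply: (hsum_ucl (f := fun p k => _)) => [p|k].
  exact: finite_seq.
by rewrite !uapp_ucl /hC !umapE dstdE umul_ucl uadd_ucl uexp_ucl.
Qed.

Lemma Cxi_ucl (xi : R[i]) (b : I1 * I2 -> R -> R) :
  Cxi H H' xi (ucl F12 b) = ucl F12 (fun p =>
    Cxi_fibre xi (rh p.2) (rh' p) (halfL p.2) (halfL' p) (b p)).
Proof.
rewrite /Cxi Xset_uext; apply: hsum_ucl => [p|a].
  exact: finite_extended_funs.
rewrite hsum_starL_ucl eps0_ucl !dstdE eps_ucl ustar_ucl /hC !umapE.
rewrite (umul_ucl F12 (fun=> pi%:C%C)).
rewrite (umul_ucl F12 (fun p => pi%:C%C * ((rh p.2)^-1)%:C%C)).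
rewrite (umul_ucl F12 (fun p => pi%:C%C * ((rh p.2)^-1)%:C%C * xi)).
by rewrite uopp_ucl /hcexp umapE umul_ucl.
Qed.

Lemma hexprz_sqr_ucl (z : R[i]) :
  hexprz (ucst F2 z) (H ^+ 2) = ucl F2 (fun m => z ^+ (halfL m + halfL m)).
Proof.
rewrite uexp_ucl /hexprz umap2E; apply/uclP.
apply: filterS h_even => m m_even /=.
by rewrite -(halfL_int m_even) mulr_natr mulr2n -PoszD.
Qed.

Lemma near_grid_le (b : I1 * I2 -> R -> R) (b0 : I2 -> R) :
  (forall k, latL H k ->
     `|uapp (ucl F12 b) (ustar F1 k)| <= ustar F1 (ucl F2 b0)) ->
  \forall m \near uf_sets F2, \forall l \near uf_sets F1,
    forall k, k \in grid (rh m)^-1 (halfL m) -> `|b (l, m) k| <= b0 m.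
Proof.
move=> b_le; apply: (near_ustar_seq (P := fun p k => `|b p k| <= b0 p.2)).
move=> k kL; have : latL H (ucl F2 k) by rewrite latL_uext; apply/uext_ucl.
by move=> /b_le; rewrite !ustar_ucl uapp_ucl unorm_ucl => /ule_ucl.
Qed.

Lemma near_cvg_Cxi_fibre (xi : R[i]) (b : I1 * I2 -> R -> R) (b0 : I2 -> R) :
  0 < complex.Re xi ->
  (forall z : ultrapower F2 int, ustar F1 z < H') ->
  (forall k, latL H k ->
     `|uapp (ucl F12 b) (ustar F1 k)| <= ustar F1 (ucl F2 b0)) ->
  \forall m \near uf_sets F2,
    Cxi_fibre xi (rh m) (rh' (l, m)) (halfL m) (halfL' (l, m)) (b (l, m))
      @[l --> uf_sets F1] --> (1 / sqrtc xi) ^+ (halfL m + halfL m).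
Proof.
move=> xi_gt0 /(ustar_lt_cvgy R) h'_cvgy /near_grid_le b_le.
apply: filterS3 h_even h'_cvgy b_le => m m_even h'm_cvgy bm_le.
have [hm_gt0 _] := m_even.
apply: (cvg_Cxi_fibre (b0 := b0 m) xi_gt0 _ h'm_cvgy).
- by rewrite ltr0z.
- by apply: filterE => l; apply: halfL'_real.
- exact: halfL_real.
- exact: bm_le.
Qed.

End CxiRepresentatives.

Theorem theorem3p2 (R : realType) (I1 I2 : Type)
    (I1_infinite : infinite_set [set: I1])
    (I2_infinite : infinite_set [set: I2])
    (F1 : ultrafilter I1) (F2 : ultrafilter I2)
    (F1_nonprincipal : nonprincipal F1) (F2_nonprincipal : nonprincipal F2)
    (H : ultrapower F2 int)
    (H_gt0 : 0 < H)
    (H_even : exists m : ultrapower F2 int, H = 2 * m)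
    (H_infinite : forall n : int, ucst F2 n < H)
    (H' : ultrapower (uprod F1 F2) int)
    (H'_gt0 : 0 < H')
    (H'_even : exists m : ultrapower (uprod F1 F2) int, H' = 2 * m)
    (H'_infinite : forall z : ultrapower F2 int, ustar F1 z < H')
    (xi : R[i]) (xi_gt0 : 0 < complex.Re xi)
    (b : ultrapower (uprod F1 F2) (R -> R))
    (bX : Xset H H' b)
    (b_bounded : exists b0 : ultrapower F2 R,
       forall k, latL H k -> `|uapp b (ustar F1 k)| <= ustar F1 b0) :
  let C := Cxi H H' xi b in
  let p := hexprz (ucst F2 (1 / sqrtc xi)) (H ^+ 2) in
  (star_bounded C /\ st C = p) /\
  (std_bounded (C / ustar F1 p) /\ bst (C / ustar F1 p) = 1).
Proof.
move=> C p; rewrite {}/C {}/p.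
elim/uclW: H H_infinite H_gt0 H_even bX b_bounded => h _ H_gt0 H_even.
elim/uclW: H' H'_even H'_gt0 H'_infinite => h' _ /ult_ucl h'_gt0 H'_infinite.
elim/uclW: b => b _ [b0]; elim/uclW: b0 => b0 b_le.
have h_even := near_pos_even H_gt0 H_even.
have Ccvg := near_cvg_Cxi_fibre h_even xi_gt0 H'_infinite b_le.
rewrite (Cxi_ucl h_even h'_gt0) (hexprz_sqr_ucl h_even).
split; first exact: (st_ucl_cvg Ccvg).
apply: (bst_ratio_cvg Ccvg); apply: filterE => m.
rewrite expf_neq0// div1r invr_eq0 sqrtc_eq0.
by apply/eqP => xi0; move: xi_gt0; rewrite xi0 ltxx.
Qed.
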